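(* Pullbacks do not always exist in the category $\mathrm{GrGp}$ of graphs of groups (with morphisms up to $\approx$-equivalence): there exist graphs of groups $\mathbb A,\mathbb B,\mathbb C$ and morphisms $\mu^B\colon\mathbb B\to\mathbb A$, $\mu^C\colon\mathbb C\to\mathbb A$ having no pullback in $\mathrm{GrGp}$. However, whenever the pullback of two morphisms $\mu^B\colon\mathbb B\to\mathbb A$ and $\mu^C\colon\mathbb C\to\mathbb A$ exists in $\mathrm{GrGp}$, it is (isomorphic in $\mathrm{GrGp}$ to) a subgraph of groups of the $\mathbb A$-product $\mathbb B\,\widetilde\times_{\mathbb A}\,\mathbb C$ of $\mu^B$ and $\mu^C$.
   Context: **Conventions.** For group elements, $x^g=g^{-1}xg$ and $\gamma_g(x)=x^g$. A graph $\mathsf A$ has a vertex set $V(\mathsf A)$, an edge set $E(\mathsf A)$, maps $o,t\colon E(\mathsf A)\to V(\mathsf A)$ and a fixed-point-free involution $e\mapsto e^{-1}$ on edges with $t(e^{-1})=o(e)$; graph morphisms preserve this structure. **Graphs of groups.** A graph of groups $\mathbb A$ consists of a graph $\mathsf A$, vertex groups $A_u$, edge groups $A_e=A_{e^{-1}}$, and monomorphisms $\alpha_e\colon A_e\to A_{o(e)}$, $\omega_e\colon A_e\to A_{t(e)}$ with $\omega_e=\alpha_{e^{-1}}$. A subgraph of groups consists of a subgraph of the underlying graph with the corresponding vertex groups, edge groups and edge maps. **Morphisms.** A morphism $\mu\colon\mathbb B\to\mathbb A$ consists of a graph morphism $\mathsf B\to\mathsf A$ (also written $\mu$), monomorphisms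 $\mu_v\colon B_v\to A_{\mu(v)}$ and $\mu_f\colon B_f\to A_{\mu(f)}$, and, for each edge $f$ of $\mathsf B$, twisting elements $f_\alpha\in A_{\mu(o(f))}$, $f_\omega\in A_{\mu(t(f))}$ with $(f^{-1})_\alpha=f_\omega$ and $(f^{-1})_\omega=f_\alpha$, such that with $e=\mu(f)$, $v=o(f)$, $v'=t(f)$: $\alpha_e\circ\mu_f=\gamma_{f_\alpha}\circ\mu_v\circ\alpha_f$ and $\omega_e\circ\mu_f=\gamma_{f_\omega}\circ\mu_{v'}\circ\omega_f$. (We often omit subscripts on $\mu$.) Morphisms $\mu\colon\mathbb C\to\mathbb B$, $\nu\colon\mathbb B\to\mathbb A$ compose in the obvious way, the $\alpha$-twisting element of an edge $g$ under $\nu\circ\mu$ being $\nu(g_\alpha)\,\mu(g)_\alpha$. **Equivalence.** Two morphisms $\mu^1,\mu^2\colon\mathbb B\to\mathbb A$ are $\approx$-equivalent if they agree on the underlying graph and there are elements $a_v\in A_{\mu^1(v)}$ ($v\in V(\mathsf B)$) and $a_f\in A_{\mu^1(f)}$ ($f\in E(\mathsf B)$) with $a_{f^{-1}}=a_f$, $\mu^2_v=\gamma_{a_v}\circ\mu^1_v$, and $a_v=f^1_\alpha\,\alpha_{\mu^1(f)}(a_f)\,(f^2_\alpha)^{-1}$ whenever $o(f)=v$, where $f^i_\alpha$ is the twisting element for $\mu^i$. The category $\mathrm{GrGp}$ has as objects the graphs of groups and as arrows the $\approx$-classes of morphisms. **Pullback.** In a category, the pullback of $\mu^B\colon B\to A$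 and $\mu^C\colon C\to A$ is an object $P$ with arrows $\rho^B\colon P\to B$, $\rho^C\colon P\to C$ such that $\mu^B\rho^B=\mu^C\rho^C$ and, for all $\sigma^B\colon P'\to B$, $\sigma^C\colon P'\to C$ with $\mu^B\sigma^B=\mu^C\sigma^C$, there is a unique $\sigma\colon P'\to P$ with $\rho^B\sigma=\sigma^B$, $\rho^C\sigma=\sigma^C$. **The $\mathbb A$-product.** Given $\mu^B\colon\mathbb B\to\mathbb A$, $\mu^C\colon\mathbb C\to\mathbb A$, the $\mathbb A$-product $\mathbb D=\mathbb B\,\widetilde\times_{\mathbb A}\,\mathbb C$ is defined as follows. For vertices $v,w$ with $\mu^B(v)=\mu^C(w)=u$ let $V_{v,w}$ be the set of double cosets $\mu^B(B_v)\,a\,\mu^C(C_w)$, $a\in A_u$; for edges $f,g$ with $\mu^B(f)=\mu^C(g)=e$ let $E_{f,g}$ be the set of double cosets $\mu^B(B_f)\,a\,\mu^C(C_g)$, $a\in A_e$. Then $V(\mathsf D)=\bigsqcup V_{v,w}$, $E(\mathsf D)=\bigsqcup E_{f,g}$; the inverse of $h\in E_{f,g}$ is the same double coset viewed in $E_{f^{-1},g^{-1}}$; and the edge $\mu^B(B_f)\,a\,\mu^C(C_g)$ has origin $\mu^B(B_{o(f)})\,(f_\alpha\alpha_e(a)g_\alpha^{-1})\,\mu^C(C_{o(g)})$ and terminus $\mu^B(B_{t(f)})\,(f_\omega\omega_e(a)g_\omega^{-1})\,\mu^C(C_{t(g)})$. Fix representatives $\tilde x\in x$ and $\tilde h=\widetilde{h^{-1}}\in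 h$ of the double cosets, and for each $h\in E_{f,g}$ with $o(h)=x\in V_{v,w}$ fix $b_h\in B_v$, $c_h\in C_w$ with $\tilde x=\mu^B(b_h)f_\alpha\alpha_e(\tilde h)g_\alpha^{-1}\mu^C(c_h)^{-1}$. Put $D_x=\{(b,c)\in B_v\times C_w:\tilde x^{-1}\mu^B(b)\tilde x=\mu^C(c)\}$, $D_h=\{(b,c)\in B_f\times C_g:\tilde h^{-1}\mu^B(b)\tilde h=\mu^C(c)\}$, $\alpha_h(b,c)=(b_h\alpha_f(b)b_h^{-1},\,c_h\alpha_g(c)c_h^{-1})$, $\omega_h=\alpha_{h^{-1}}$. The projections $\rho^B\colon\mathbb D\to\mathbb B$, $\rho^C\colon\mathbb D\to\mathbb C$ send $x\in V_{v,w}$ to $v$, $w$ and $h\in E_{f,g}$ to $f$, $g$, are the coordinate projections on vertex and edge groups, and have $\alpha$-twisting elements $b_h$, $c_h$. Different choices of representatives give isomorphic results. *)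

(* Defs.v *)
From HB Require Import structures.
From mathcomp Require Import all_boot boolp classical_sets.

Set Implicit Arguments.
Unset Strict Implicit.
Unset Printing Implicit Defensive.

Local Open Scope group_scope.

(* [x ^ g] is the library's conjugation g^-1 * (x * g). *)


Record mono (G H : groupType) := Mono {
  mono_hom :> UMagmaMorphism.type G H;
  mono_inj : injective mono_hom
}.

Section MonoOf.
Variables (G H : groupType) (f : G -> H).
Variables (fM : {morph f : x y / x * y}) (fI : injective f).

Lemma mono_of_subproof : monoid_morphism f.
Proof. by split=> //; apply: (mulgI (f 1)); rewrite -fM !mulg1. Qed.

Definition mono_of_hom : UMagmaMorphism.type G H :=
  HB.pack_for (UMagmaMorphism.type G H) f
    (isUMagmaMorphism.Build G H f mono_of_subproof).

Definition mono_of : mono G H := @Mono G H mono_of_hom fI.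

Lemma mono_ofE x : mono_of x = f x.
Proof. by []. Qed.
End MonoOf.

Definition mono_id (G : groupType) : mono G G :=
  @mono_of G G idfun (fun _ _ => erefl) (@inj_id G).

Section MonoComp.
Variables (G H K : groupType) (g : mono H K) (f : mono G H).

Lemma mono_comp_morph : {morph (g \o f : G -> K) : x y / x * y}.
Proof. by move=> x y /=; rewrite !gmulfM. Qed.

Definition mono_comp : mono G K :=
  mono_of mono_comp_morph (inj_comp (@mono_inj _ _ g) (@mono_inj _ _ f)).

Lemma mono_compE x : mono_comp x = g (f x).
Proof. by []. Qed.
End MonoComp.

(* Equations between vertices or between edges, and A_(e^-1) = A_e, are only
   propositional, so group elements are transported along equalities of groups;
   by proof irrelevance the transport does not depend on the equality proof. *)
Definition gcast (G H : groupType) (p : G = H) : mono G H :=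
  match p in _ = H' return mono G H' with erefl => mono_id G end.

Lemma gcast_id (G : groupType) (p : G = G) x : gcast p x = x.
Proof. by rewrite (Prop_irrelevance p erefl). Qed.

Lemma gcast_comp (G H K : groupType) (p : G = H) (q : H = K) (r : G = K) x :
  gcast q (gcast p x) = gcast r x.
Proof. by subst; rewrite !gcast_id. Qed.

Lemma gcast_irr (G H : groupType) (p q : G = H) x : gcast p x = gcast q x.
Proof. by rewrite (Prop_irrelevance p q). Qed.

Lemma gcast_nat (T : Type) (P Q : T -> groupType)
    (F : forall t, mono (P t) (Q t)) t t' (p : t = t')
    (q : P t = P t') (r : Q t = Q t') x :
  F t' (gcast q x) = gcast r (F t x).
Proof. by subst; rewrite !gcast_id. Qed.

Lemma gcast_section (T : Type) (P : T -> groupType) (a : forall t, P t) t t'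
    (p : t = t') (q : P t = P t') : gcast q (a t) = a t'.
Proof. by subst; rewrite gcast_id. Qed.

Record graph := Graph {
  vertex : Type;
  edge : Type;
  org : edge -> vertex;
  einv : edge -> edge;
  einvK : involutive einv;
  einv_neq : forall e, einv e <> e
}.

(* The law t(e^-1) = o(e) is then [einvK]. *)
Definition ter (G : graph) (e : edge G) : vertex G := org (einv e).

Record gmorphism (G H : graph) := GMorphism {
  gmV : vertex G -> vertex H;
  gmE : edge G -> edge H;
  gm_org : forall e, org (gmE e) = gmV (org e);
  gm_inv : forall e, gmE (einv e) = einv (gmE e)
}.

Lemma gm_ter G H (m : gmorphism G H) e : ter (gmE m e) = gmV m (ter e).
Proof. by rewrite /ter -gm_inv gm_org. Qed.

Definition gm_id G : gmorphism G G :=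
  @GMorphism G G id id (fun=> erefl) (fun=> erefl).

Lemma gm_comp_org G H K (n : gmorphism H K) (m : gmorphism G H) e :
  org (gmE n (gmE m e)) = gmV n (gmV m (org e)).
Proof. by rewrite !gm_org. Qed.

Lemma gm_comp_inv G H K (n : gmorphism H K) (m : gmorphism G H) e :
  gmE n (gmE m (einv e)) = einv (gmE n (gmE m e)).
Proof. by rewrite !gm_inv. Qed.

Definition gm_comp G H K (n : gmorphism H K) (m : gmorphism G H) :
    gmorphism G K :=
  @GMorphism G K (gmV n \o gmV m) (gmE n \o gmE m)
    (gm_comp_org n m) (gm_comp_inv n m).

Record graph_of_groups := GraphOfGroups {
  ugraph :> graph;
  vgrp : vertex ugraph -> groupType;
  egrp : edge ugraph -> groupType;
  egrp_inv : forall e, egrp (einv e) = egrp e;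
  galpha : forall e, mono (egrp e) (vgrp (org e))
}.

Definition gomega (A : graph_of_groups) (e : edge A) :
    mono (egrp e) (vgrp (ter e)) :=
  mono_comp (galpha (einv e)) (gcast (esym (egrp_inv e))).

Definition vcast (A : graph_of_groups) (u u' : vertex A) (p : u = u') :
    mono (vgrp u) (vgrp u') := gcast (f_equal (@vgrp A) p).

Definition ecast (A : graph_of_groups) (e e' : edge A) (p : e = e') :
    mono (egrp e) (egrp e') := gcast (f_equal (@egrp A) p).

(* The equation A_(m f^-1) = A_((m f)^-1) = A_(m f) *)
Definition egrp_gm_inv (B : graph) (A : graph_of_groups) (m : gmorphism B A)
    (f : edge B) : egrp (gmE m (einv f)) = egrp (gmE m f) :=
  etrans (f_equal (@egrp A) (gm_inv m f)) (egrp_inv (gmE m f)).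

(* [tw f] is f_alpha. The other twisting element f_omega is [tw (einv f)], an
   element of A_(m (t f)), so that (f^-1)_omega = f_alpha is [einvK]. That
   [mE (einv f)] and [mE f] are the same map follows from the two equations and
   the injectivity of the boundary maps, see [mE_inv]. *)
Record morphism (B A : graph_of_groups) := Morphism {
  mgr :> gmorphism B A;
  mV : forall v, mono (vgrp v) (vgrp (gmV mgr v));
  mE : forall f, mono (egrp f) (egrp (gmE mgr f));
  tw : forall f, vgrp (gmV mgr (org f));
  m_alpha : forall f x,
    vcast (gm_org mgr f) (galpha (gmE mgr f) (mE f x)) =
    mV (org f) (galpha f x) ^ tw f;
  m_omega : forall f x,
    vcast (gm_ter mgr f) (gomega (gmE mgr f) (mE f x)) =
    mV (ter f) (gomega f x) ^ tw (einv f)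
}.

Arguments m_alpha {B A} m f x.
Arguments m_omega {B A} m f x.

Lemma galpha_ecast (A : graph_of_groups) (e e' : edge A) (p : e = e')
    (q : egrp e = egrp e') (r : vgrp (org e) = vgrp (org e')) x :
  galpha e' (gcast q x) = gcast r (galpha e x).
Proof. exact: (gcast_nat (fun e => @galpha A e) p). Qed.

Lemma mE_inv (B A : graph_of_groups) (m : morphism B A) (f : edge B)
    (p : egrp f = egrp (einv f))
    (q : egrp (gmE m f) = egrp (gmE m (einv f))) x :
  mE m (einv f) (gcast p x) = gcast q (mE m f x).
Proof.
apply: (@mono_inj _ _ (galpha _)); apply: (@mono_inj _ _ (vcast (gm_org m _))).
rewrite m_alpha; have := m_omega m f x.
rewrite /gomega !mono_compE (gcast_irr _ p) => <-.
set y := mE m f x; rewrite /vcast.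
have r : egrp (einv (gmE m f)) = egrp (gmE m (einv f)) by rewrite gm_inv.
rewrite -(gcast_comp (esym (egrp_inv (gmE m f))) r).
have s : vgrp (org (einv (gmE m f))) = vgrp (org (gmE m (einv f))).
  by rewrite gm_inv.
rewrite (galpha_ecast (esym (gm_inv m f)) r s); symmetry; exact: gcast_comp.
Qed.

Lemma mV_vcast (B A : graph_of_groups) (m : morphism B A) (v v' : vertex B)
    (p : v = v') x :
  mV m v' (vcast p x) = vcast (f_equal (gmV m) p) (mV m v x).
Proof. by subst. Qed.

Section MorphismOf.
Variables (B A : graph_of_groups) (m : gmorphism B A).
Variable (fV : forall v, mono (vgrp v) (vgrp (gmV m v))).
Variable (fE : forall f, mono (egrp f) (egrp (gmE m f))).
Variable (t : forall f, vgrp (gmV m (org f))).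
Hypothesis fE_inv : forall f x,
  fE (einv f) (gcast (esym (egrp_inv f)) x) =
  gcast (esym (egrp_gm_inv m f)) (fE f x).
Hypothesis f_alpha : forall f x,
    vcast (gm_org m f) (galpha (gmE m f) (fE f x)) =
    fV (org f) (galpha f x) ^ t f.

Lemma morphism_of_omega f x :
    vcast (gm_ter m f) (gomega (gmE m f) (fE f x)) =
    fV (ter f) (gomega f x) ^ t (einv f).
Proof.
rewrite /gomega !mono_compE -f_alpha fE_inv /vcast.
have s : vgrp (org (gmE m (einv f))) = vgrp (org (einv (gmE m f))).
  by rewrite gm_inv.
have r : egrp (gmE m (einv f)) = egrp (einv (gmE m f)) by rewrite gm_inv.
rewrite -(gcast_comp (esym (egrp_gm_inv m f)) r).
by rewrite (galpha_ecast (gm_inv m f) r s); exact: gcast_comp.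
Qed.

Definition morphism_of : morphism B A := Morphism f_alpha morphism_of_omega.
End MorphismOf.

Section Identity.
Variable A : graph_of_groups.

Lemma mor_id_inv (f : edge A) (x : egrp f) :
  mono_id (egrp (einv f)) (gcast (esym (egrp_inv f)) x) =
  gcast (esym (egrp_gm_inv (gm_id A) f)) (mono_id (egrp f) x).
Proof. exact: gcast_irr. Qed.

Lemma mor_id_alpha (f : edge A) (x : egrp f) :
  vcast (gm_org (gm_id A) f) (galpha f (mono_id _ x)) =
  (mono_id _ (galpha f x)) ^ (1 : vgrp (org f)).
Proof. by rewrite conjg1. Qed.

Definition mor_id : morphism A A :=
  @morphism_of A A (gm_id A) (fun v => mono_id _) (fun e => mono_id _)
    (fun e => 1) mor_id_inv mor_id_alpha.
End Identity.

Section Composition.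
Variables (C B A : graph_of_groups) (n : morphism B A) (m : morphism C B).
Let nm := gm_comp n m.

Definition comp_mV v : mono (vgrp v) (vgrp (gmV nm v)) :=
  mono_comp (mV n _) (mV m v).

Definition comp_mE f : mono (egrp f) (egrp (gmE nm f)) :=
  mono_comp (mE n _) (mE m f).

Definition comp_tw f : vgrp (gmV nm (org f)) :=
  mV n _ (tw m f) * vcast (f_equal (gmV n) (gm_org m f)) (tw n (gmE m f)).

Lemma mor_comp_inv f x :
  comp_mE (einv f) (gcast (esym (egrp_inv f)) x) =
  gcast (esym (egrp_gm_inv nm f)) (comp_mE f x).
Proof.
rewrite /comp_mE !mono_compE (mE_inv _ (esym (egrp_gm_inv m f))).
set y := mE m f x.
have p : egrp (gmE m f) = egrp (einv (gmE m f)) by rewrite egrp_inv.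
have q : egrp (einv (gmE m f)) = egrp (gmE m (einv f)) by rewrite gm_inv.
rewrite -(gcast_comp p q).
have r : egrp (gmE n (einv (gmE m f))) = egrp (gmE n (gmE m (einv f))).
  by rewrite (gm_inv m).
rewrite (gcast_nat (fun e => @mE _ _ n e) (esym (gm_inv m f)) q r).
by rewrite (mE_inv _ (esym (egrp_gm_inv n _))); exact: gcast_comp.
Qed.

Lemma mor_comp_alpha f x :
    vcast (gm_org nm f) (galpha (gmE nm f) (comp_mE f x)) =
    comp_mV (org f) (galpha f x) ^ comp_tw f.
Proof.
rewrite /comp_mE /comp_mV !mono_compE /comp_tw conjgM -gmulfJ -m_alpha.
rewrite mV_vcast -gmulfJ -m_alpha; symmetry; exact: gcast_comp.
Qed.

Definition mor_comp : morphism C A :=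
  morphism_of mor_comp_inv mor_comp_alpha.
End Composition.


Lemma vcast_id (A : graph_of_groups) (u : vertex A) (p : u = u) x :
  vcast p x = x.
Proof. exact: gcast_id. Qed.

(* [pV] and the unnamed witness say that the underlying graph morphisms agree;
   the first conjunct is a_(f^-1) = a_f. *)
Definition mequiv (B A : graph_of_groups) (m1 m2 : morphism B A) : Prop :=
  exists (pV : forall v, gmV m2 v = gmV m1 v)
         (_ : forall f, gmE m2 f = gmE m1 f)
         (a : forall v, vgrp (gmV m1 v))
         (ae : forall f, egrp (gmE m1 f)),
  [/\ forall f, gcast (egrp_gm_inv m1 f) (ae (einv f)) = ae f,
      forall v x, vcast (pV v) (mV m2 v x) = mV m1 v x ^ a v
    & forall f, a (org f) =
        tw m1 f * vcast (gm_org m1 f) (galpha (gmE m1 f) (ae f))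
        * (vcast (pV (org f)) (tw m2 f))^-1].

Lemma gmorphism_eq (G H : graph) (m1 m2 : gmorphism G H) :
  gmV m1 =1 gmV m2 -> gmE m1 =1 gmE m2 -> m1 = m2.
Proof.
case: m1 m2 => V1 E1 o1 i1 [V2 E2 o2 i2] /= /funext eV /funext eE; subst.
by rewrite (Prop_irrelevance o1 o2) (Prop_irrelevance i1 i2).
Qed.

Section Equiv.
Variables B A : graph_of_groups.
Implicit Types m : morphism B A.

(* [mequiv] for two morphisms with convertible underlying graph morphisms *)
Definition mequiv_on m1 (fV : forall v, mono (vgrp v) (vgrp (gmV m1 v)))
    (t : forall f, vgrp (gmV m1 (org f))) : Prop :=
  exists (a : forall v, vgrp (gmV m1 v)) (ae : forall f, egrp (gmE m1 f)),
  [/\ forall f, gcast (egrp_gm_inv m1 f) (ae (einv f)) = ae f,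
      forall v x, fV v x = mV m1 v x ^ a v
    & forall f, a (org f) =
        tw m1 f * vcast (gm_org m1 f) (galpha (gmE m1 f) (ae f)) * (t f)^-1].

Lemma mequiv_elim m1 (Q : morphism B A -> Prop) :
  (forall fV fE t H1 H2, let m2 := @Morphism B A (mgr m1) fV fE t H1 H2 in
    mequiv_on fV t -> Q m2) ->
  forall m2, mequiv m1 m2 -> Q m2.
Proof.
move=> h [g2 fV fE t H1 H2] /= [pV [pE [a [ae [ca cV cE]]]]].
have eg : mgr m1 = g2 by apply: gmorphism_eq => ?.
move: fV fE t H1 H2 pV pE cV cE; case: _ / eg => fV fE t H1 H2 pV pE /= cV cE.
apply: h; exists a, ae; split=> // [v x|f].
  by rewrite -cV vcast_id.
by rewrite cE vcast_id.
Qed.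

Lemma mequiv_same (g : gmorphism B A) fV1 fE1 t1 H11 H12
    fV fE t H1 H2 :
  let m1 := @Morphism B A g fV1 fE1 t1 H11 H12 in
  mequiv_on (m1 := m1) fV t ->
  mequiv m1 (@Morphism B A g fV fE t H1 H2).
Proof.
move=> m1 [a [ae [ca cV cE]]].
exists (fun=> erefl), (fun=> erefl), a, ae; split=> //=.
Qed.

Lemma mequiv_pointwise m1 m2 (pV : forall v, gmV m2 v = gmV m1 v) :
  (forall f, gmE m2 f = gmE m1 f) ->
  (forall v x, vcast (pV v) (mV m2 v x) = mV m1 v x) ->
  (forall f, vcast (pV (org f)) (tw m2 f) = tw m1 f) -> mequiv m1 m2.
Proof.
move=> pE cV cE; exists pV, pE, (fun=> 1), (fun=> 1); split=> [f|v x|f].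
- exact: gmulf1.
- by rewrite conjg1.
- by rewrite cE !gmulf1 mulg1 mulgV.
Qed.

Lemma mequiv_refl m : mequiv m m.
Proof. exact: (@mequiv_pointwise m m (fun=> erefl)). Qed.

Lemma mequiv_sym m1 m2 : mequiv m1 m2 -> mequiv m2 m1.
Proof.
case: m1 => g fV1 fE1 t1 H11 H12.
move: m2; apply: mequiv_elim => /= fV fE t H1 H2 [a [ae [ca cV cE]]].
apply: mequiv_same; exists (fun v => (a v)^-1), (fun f => (ae f)^-1).
split=> /= [f|v x|f].
- by rewrite gmulfV ca.
- by rewrite cV -conjgM mulgV conjg1.
- by rewrite cE !invgM invgK !gmulfV mulgA.
Qed.

Lemma mequiv_trans m1 m2 m3 : mequiv m1 m2 -> mequiv m2 m3 -> mequiv m1 m3.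
Proof.
case: m1 => g fV1 fE1 t1 H11 H12 e12; move: m2 e12 m3.
apply: mequiv_elim => /= fV2 fE2 t2 H21 H22 [a [ae [ca cV cE]]].
apply: mequiv_elim => /= fV3 fE3 t3 H31 H32 [b [be [cb dV dE]]].
apply: mequiv_same; exists (fun v => a v * b v), (fun f => ae f * be f).
split=> /= [f|v x|f].
- by rewrite gmulfM ca cb.
- by rewrite dV cV -conjgM.
- by rewrite cE dE !gmulfM !mulgA mulgVK.
Qed.
End Equiv.

Lemma mE_inv_cast (B A : graph_of_groups) (m : morphism B A) (e e' : edge B)
    (h : e' = einv e) (q : egrp e' = egrp e)
    (r : egrp (gmE m e') = egrp (gmE m e)) x :
  mE m e (gcast q x) = gcast r (mE m e' x).
Proof.
subst e'; apply: (@mono_inj _ _ (gcast (esym r))).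
rewrite (gcast_comp r (esym r) erefl) gcast_id -(mE_inv (esym q) (esym r)).
by rewrite (gcast_comp q (esym q) erefl) gcast_id.
Qed.

Lemma mequiv_comp (C B A : graph_of_groups)
    (n1 n2 : morphism B A) (m1 m2 : morphism C B) :
  mequiv n1 n2 -> mequiv m1 m2 -> mequiv (mor_comp n1 m1) (mor_comp n2 m2).
Proof.
move: n2; apply: mequiv_elim => gV gE s G1 G2 n2 [b [be [cb dV dE]]].
move: m2; apply: mequiv_elim => fV fE t H1 H2 m2 [a [ae [ca cV cE]]].
apply: mequiv_same => /=.
exists (fun v => mV n1 _ (a v) * b (gmV m1 v)).
exists (fun f => mE n1 _ (ae f) * be (gmE m1 f)); split=> /= [f|v x|f].
- rewrite gmulfM; congr (_ * _).
    by rewrite -[in RHS]ca; symmetry; apply: mE_inv_cast; rewrite gm_inv.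
  rewrite -[in RHS]cb -(@gcast_section _ _ be _ _ (gm_inv m1 f)
    (f_equal (fun e => egrp (gmE n1 e)) (gm_inv m1 f))).
  by symmetry; exact: gcast_comp.
- by rewrite cV dV gmulfJ -conjgM.
- rewrite /comp_tw /= dV cE.
  set k := gm_org m1 f.
  have -> : b (gmV m1 (org f)) =
      vcast (f_equal (gmV n1) k) (b (org (gmE m1 f))).
    by symmetry; exact: (gcast_section b k).
  have e1 x : vcast (gm_comp_org n1 m1 f) x =
      vcast (f_equal (gmV n1) k) (vcast (gm_org n1 _) x).
    by symmetry; exact: gcast_comp.
  rewrite !gmulfM !gmulfV !e1 m_alpha mV_vcast gmulfJ.
  set T1 := mV n1 _ (tw m1 f); set T := mV n1 _ (t f).
  set N := vcast (f_equal (gmV n1) k).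
  set P := N (mV n1 _ _); rewrite dE !gmulfM !gmulfV.
  set X := N (tw n1 _); set Y := N (vcast _ _); set S := N (s _).
  by rewrite !conjgE !invgM !invgK -!mulgA !(mulKg, mulVKg).
Qed.

Section CompLaws.
Variables D C B A : graph_of_groups.

Lemma mor_compA (n : morphism B A) (m : morphism C B) (l : morphism D C) :
  mequiv (mor_comp n (mor_comp m l)) (mor_comp (mor_comp n m) l).
Proof.
apply: (@mequiv_pointwise _ _
  (mor_comp n (mor_comp m l)) (mor_comp (mor_comp n m) l) (fun=> erefl))
  => // f.
rewrite vcast_id /= /comp_tw /= /comp_tw !gmulfM mulgA; congr (_ * _ * _).
  by rewrite mV_vcast; exact: gcast_irr.
exact: gcast_comp.
Qed.

Lemma mor_comp1l (m : morphism C B) : mequiv (mor_comp (mor_id B) m) m.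
Proof.
apply: (@mequiv_pointwise _ _
  (mor_comp (mor_id B) m) m (fun=> erefl)) => // f.
by rewrite vcast_id /= /comp_tw /= gmulf1 mulg1.
Qed.

Lemma mor_comp1r (m : morphism C B) : mequiv (mor_comp m (mor_id C)) m.
Proof.
apply: (@mequiv_pointwise _ _
  (mor_comp m (mor_id C)) m (fun=> erefl)) => // f.
by rewrite vcast_id /= /comp_tw /= gmulf1 mul1g.
Qed.
End CompLaws.

Record category := Category {
  obj : Type;
  hom : obj -> obj -> Type;
  idhom : forall X, hom X X;
  chom : forall X Y Z, hom Y Z -> hom X Y -> hom X Z;
  chomA : forall X Y Z W (h : hom Z W) (g : hom Y Z) (f : hom X Y),
    chom h (chom g f) = chom (chom h g) f;
  chom1l : forall X Y (f : hom X Y), chom (idhom Y) f = f;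
  chom1r : forall X Y (f : hom X Y), chom f (idhom X) = f
}.

Definition isomorphic (K : category) (X Y : obj K) : Prop :=
  exists (f : hom X Y) (g : hom Y X),
    chom g f = idhom X /\ chom f g = idhom Y.

Definition is_pullback (K : category) (A B C P : obj K)
    (muB : hom B A) (muC : hom C A) (rhoB : hom P B) (rhoC : hom P C) : Prop :=
  chom muB rhoB = chom muC rhoC /\
  forall (P' : obj K) (sB : hom P' B) (sC : hom P' C),
    chom muB sB = chom muC sC ->
    exists! s : hom P' P, chom rhoB s = sB /\ chom rhoC s = sC.

Definition has_pullback (K : category) (A B C : obj K)
    (muB : hom B A) (muC : hom C A) : Prop :=
  exists (P : obj K) (rhoB : hom P B) (rhoC : hom P C),
    is_pullback muB muC rhoB rhoC.

(* Classes of [mequiv], which is an equivalence relation by [mequiv_refl],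
   [mequiv_sym] and [mequiv_trans]. *)
Definition arrow (B A : graph_of_groups) : Type :=
  {S : set (morphism B A) | exists m, S = mequiv m}.

Definition mclass (B A : graph_of_groups) (m : morphism B A) : arrow B A :=
  exist _ (mequiv m : set (morphism B A)) (ex_intro _ m erefl).

Lemma mclassP (B A : graph_of_groups) (x : arrow B A) :
  exists m, x = mclass m.
Proof. by case: x => S [m eS]; exists m; apply: eq_exist. Qed.

Lemma mclass_eq (B A : graph_of_groups) (m1 m2 : morphism B A) :
  mclass m1 = mclass m2 <-> mequiv m1 m2.
Proof.
split=> [[e]|e12].
  by have : mequiv m2 m2 := mequiv_refl m2; rewrite -e.
apply: eq_exist; apply/predeqP => m; split=> e.
  by apply: mequiv_trans e; exact: mequiv_sym.
exact: mequiv_trans e.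
Qed.

Definition arepr (B A : graph_of_groups) (x : arrow B A) : morphism B A :=
  projT1 (cid (mclassP x)).

Lemma areprK (B A : graph_of_groups) (x : arrow B A) : mclass (arepr x) = x.
Proof. by rewrite /arepr; case: cid. Qed.

Definition arrow_comp (C B A : graph_of_groups)
    (y : arrow B A) (x : arrow C B) : arrow C A :=
  mclass (mor_comp (arepr y) (arepr x)).

Lemma arrow_compE (C B A : graph_of_groups)
    (n : morphism B A) (m : morphism C B) :
  arrow_comp (mclass n) (mclass m) = mclass (mor_comp n m).
Proof.
by apply/mclass_eq/mequiv_comp; apply/mclass_eq; rewrite areprK.
Qed.

Lemma arrow_compA (D C B A : graph_of_groups)
    (z : arrow B A) (y : arrow C B) (x : arrow D C) :
  arrow_comp z (arrow_comp y x) = arrow_comp (arrow_comp z y) x.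
Proof.
have [[n ->] [m ->] [l ->]] := And3 (mclassP z) (mclassP y) (mclassP x).
by rewrite !arrow_compE; apply/mclass_eq; exact: mor_compA.
Qed.

Lemma arrow_comp1l (B A : graph_of_groups) (x : arrow B A) :
  arrow_comp (mclass (mor_id A)) x = x.
Proof.
by have [m ->] := mclassP x; rewrite arrow_compE; apply/mclass_eq/mor_comp1l.
Qed.

Lemma arrow_comp1r (B A : graph_of_groups) (x : arrow B A) :
  arrow_comp x (mclass (mor_id B)) = x.
Proof.
by have [m ->] := mclassP x; rewrite arrow_compE; apply/mclass_eq/mor_comp1r.
Qed.

Definition GrGp : category :=
  Category arrow_compA arrow_comp1l arrow_comp1r.

Record subgraph (G : graph) := Subgraph {
  sub_vertex : set (vertex G);
  sub_edge : set (edge G);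
  sub_org : forall e, sub_edge e -> sub_vertex (org e);
  sub_inv : forall e, sub_edge e -> sub_edge (einv e)
}.

Section Restrict.
Variables (G : graph) (S : subgraph G).

Definition restr_vertex : Type := {v : vertex G | sub_vertex S v}.
Definition restr_edge : Type := {e : edge G | sub_edge S e}.

Definition restr_org (e : restr_edge) : restr_vertex :=
  exist _ (org (sval e)) (sub_org (svalP e)).

Definition restr_einv (e : restr_edge) : restr_edge :=
  exist _ (einv (sval e)) (sub_inv (svalP e)).

Lemma restr_einvK : involutive restr_einv.
Proof. by case=> e Se; apply: eq_exist; exact: einvK. Qed.

Lemma restr_einv_neq e : restr_einv e <> e.
Proof. by move/(congr1 sval); exact: einv_neq. Qed.

Definition restr_graph : graph :=
  @Graph restr_vertex restr_edge restr_org restr_einv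
    restr_einvK restr_einv_neq.
End Restrict.

Definition sub_graph_of_groups (A : graph_of_groups) (S : subgraph A) :
    graph_of_groups :=
  @GraphOfGroups (restr_graph S)
    (fun v => vgrp (sval v)) (fun e => egrp (sval e))
    (fun e => egrp_inv (sval e)) (fun e => galpha (sval e)).

Definition dcoset (G H K : groupType) (phi : mono G K) (psi : mono H K)
    (a : K) : set K :=
  [set k | exists g h, k = phi g * a * psi h].

Section Subgroup.
Variables (G : groupType) (S : pred G).

Record subgrp (cl : group_closed S) := Subgrp {
  subgrp_val : G;
  subgrpP : S subgrp_val
}.

Variable cl : group_closed S.
HB.instance Definition _ := [isSub of subgrp cl for @subgrp_val cl].
HB.instance Definition _ := [Choice of subgrp cl by <:].
HB.instance Definition _ := SubChoice_isSubGroup.Build G S (subgrp cl) cl.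
End Subgroup.

Section Fibre.
Variables (G H K : groupType) (phi : mono G K) (psi : mono H K) (a : K).

Definition fibre : pred (G * H) := fun bc => phi bc.1 ^ a == psi bc.2.

Lemma fibre_closed : group_closed fibre.
Proof.
split; first by rewrite unfold_in /fibre /= !gmulf1 conj1g.
move=> x y; rewrite !unfold_in /fibre /= => /eqP ex /eqP ey.
by rewrite !gmulfM !gmulfV conjMg conjVg ex ey.
Qed.
End Fibre.

Definition fibre_product (G H K : groupType)
    (phi : mono G K) (psi : mono H K) (a : K) : groupType :=
  subgrp (fibre_closed phi psi a).

Lemma subgrp_eq (G : groupType) (S S' : pred G)
    (cl : group_closed S) (cl' : group_closed S') :
  S =1 S' -> subgrp cl = subgrp cl' :> groupType.
Proof.
by move=> /funext e; subst S'; rewrite (Prop_irrelevance cl cl').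
Qed.

Lemma fibre_product_eq (G G' H H' K K' : groupType)
    (pG : G = G') (pH : H = H') (pK : K = K')
    (phi : mono G K) (psi : mono H K) (a : K)
    (phi' : mono G' K') (psi' : mono H' K') (a' : K') :
  (forall x, phi' (gcast pG x) = gcast pK (phi x)) ->
  (forall x, psi' (gcast pH x) = gcast pK (psi x)) ->
  a' = gcast pK a -> fibre_product phi psi a = fibre_product phi' psi' a'.
Proof.
subst => /= ephi epsi ->; apply: subgrp_eq => x.
by rewrite /fibre -ephi -epsi.
Qed.

(* The components of m, read in the groups of a vertex u (edge e) of A that is
   propositionally equal to the image of v (f). *)
Section Localize.
Variables (B A : graph_of_groups) (m : morphism B A).

Definition mV_at v u (p : gmV m v = u) : mono (vgrp v) (vgrp u) :=
  mono_comp (vcast p) (mV m v).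

Definition mE_at f e (p : gmE m f = e) : mono (egrp f) (egrp e) :=
  mono_comp (ecast p) (mE m f).

Definition org_at f e (p : gmE m f = e) : gmV m (org f) = org e :=
  etrans (esym (gm_org m f)) (f_equal (@org A) p).

Definition einv_at f e (p : gmE m f = e) : gmE m (einv f) = einv e :=
  etrans (gm_inv m f) (f_equal (@einv A) p).

Definition tw_at f e (p : gmE m f = e) : vgrp (org e) :=
  vcast (org_at p) (tw m f).

Lemma galpha_at f e (p : gmE m f = e) x :
  galpha e (mE_at p x) = mV_at (org_at p) (galpha f x) ^ tw_at p.
Proof.
subst e; rewrite /tw_at /mV_at /mE_at /= -gmulfJ -m_alpha.
by symmetry; rewrite [LHS](gcast_comp _ _ erefl).
Qed.

Lemma mE_at_inv f e (p : gmE m f = e) x :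
  mE_at (einv_at p) (gcast (esym (egrp_inv f)) x) =
  gcast (esym (egrp_inv e)) (mE_at p x).
Proof.
subst e; rewrite /mE_at /= (mE_inv _ (esym (egrp_gm_inv m f))).
exact: gcast_comp.
Qed.
End Localize.

Section Product.
Variables (A B C : graph_of_groups).
Variables (mB : morphism B A) (mC : morphism C A).

(* The elements of the disjoint union of the V_(v,w), resp. of the E_(f,g): the
   double coset is stored as a subset of A_u, resp. A_e. *)
Record pvertex := PVertex {
  pvA : vertex A;
  pvB : vertex B;
  pvC : vertex C;
  pvBA : gmV mB pvB = pvA;
  pvCA : gmV mC pvC = pvA;
  pvset : set (vgrp pvA);
  pvset_dcoset : exists a, pvset = dcoset (mV_at pvBA) (mV_at pvCA) a
}.

Record pedge := PEdge {
  peA : edge A;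
  peB : edge B;
  peC : edge C;
  peBA : gmE mB peB = peA;
  peCA : gmE mC peC = peA;
  peset : set (egrp peA);
  peset_dcoset : exists a, peset = dcoset (mE_at peBA) (mE_at peCA) a
}.

Arguments pvset p : clear implicits.
Arguments peset p : clear implicits.

Definition pinv_set (h : pedge) : set (egrp (einv (peA h))) :=
  [set a | peset h (gcast (egrp_inv (peA h)) a)].

Arguments pinv_set h : clear implicits.

Lemma pinv_dcoset (h : pedge) : exists a,
  pinv_set h = dcoset (mE_at (einv_at (peBA h))) (mE_at (einv_at (peCA h))) a.
Proof.
case: h => e f g pB pC S [a eS]; rewrite /pinv_set /=; subst S.
exists (gcast (esym (egrp_inv e)) a); apply/predeqP => k; split.
  move=> [b [c ek]]; exists (gcast (esym (egrp_inv f)) b).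
  exists (gcast (esym (egrp_inv g)) c).
  rewrite !mE_at_inv -!gmulfM -ek; symmetry.
  by rewrite (gcast_comp _ _ erefl).
move=> [b [c ->]]; exists (gcast (egrp_inv f) b), (gcast (egrp_inv g) c).
apply: (@mono_inj _ _ (gcast (esym (egrp_inv e)))).
rewrite (gcast_comp _ _ erefl) gcast_id !gmulfM -!mE_at_inv.
by rewrite !(gcast_comp _ _ erefl) !gcast_id.
Qed.

Definition pinv (h : pedge) : pedge := PEdge (pinv_dcoset h).

Definition porg_elt (h : pedge) (a : egrp (peA h)) : vgrp (org (peA h)) :=
  tw_at (peBA h) * galpha (peA h) a * (tw_at (peCA h))^-1.

(* The double coset of [porg_elt a] is the same for all a in h, so the union
   over a in h is that double coset, see [porg_dcoset]. The terminus of h, defined as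
   the origin of h^-1, is the double coset of f_omega omega_e(a) g_omega^-1. *)
Definition porg_set (h : pedge) : set (vgrp (org (peA h))) :=
  [set k | exists2 a, peset h a &
    dcoset (mV_at (org_at (peBA h))) (mV_at (org_at (peCA h)))
      (porg_elt a) k].

Arguments porg_set h : clear implicits.

Lemma porg_dcoset (h : pedge) : exists a,
  porg_set h = dcoset (mV_at (org_at (peBA h))) (mV_at (org_at (peCA h))) a.
Proof.
case: h => e f g pB pC S [a eS]; rewrite /porg_set /porg_elt /=; subst S.
exists (tw_at pB * galpha e a * (tw_at pC)^-1); apply/predeqP => k; split.
  move=> [_ [b [c ->]] [b' [c' ->]]].
  exists (b' * galpha f b), (galpha g c * c').
  by rewrite !gmulfM !galpha_at !conjgE !mulgA !mulgK.
move=> ek; exists a => //; exists 1, 1.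
by rewrite !gmulf1 mul1g mulg1.
Qed.

Definition porg (h : pedge) : pvertex := PVertex (porg_dcoset h).

Lemma pedge_eq (h h' : pedge) (p : peA h = peA h') :
  peB h = peB h' -> peC h = peC h' ->
  (forall a, peset h' (ecast p a) <-> peset h a) -> h = h'.
Proof.
case: h h' p => e f g pB pC S dS [e' f' g' pB' pC' S' dS'] /= p ef eg.
subst f' g'; move: pB' pC' S' dS'; case: _ / p => pB' pC' S' dS' eS.
have eSS : S = S' by apply/predeqP => a; rewrite -eS.
subst S'; rewrite (Prop_irrelevance pB' pB) (Prop_irrelevance pC' pC) in dS' *.
by rewrite (Prop_irrelevance dS dS').
Qed.

Lemma pinvK : involutive pinv.
Proof.
move=> h; apply: (@pedge_eq (pinv (pinv h)) h (einvK (peA h)));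
  try exact: einvK.
move=> a /=; rewrite /pinv_set /=.
by rewrite (gcast_comp _ _ (f_equal (@egrp A) (einvK (peA h)))).
Qed.

Lemma pinv_neq h : pinv h <> h.
Proof. by move/(congr1 peA); exact: einv_neq. Qed.

Definition product_graph : graph :=
  @Graph pvertex pedge porg pinv pinvK pinv_neq.

(* [vrep] and [erep] are the representatives of the double cosets, [wB h] and
   [wC h] the elements b_h and c_h. *)
Record product_choice := ProductChoice {
  vrep : forall x : pvertex, vgrp (pvA x);
  vrepP : forall x, pvset x (vrep x);
  erep : forall h : pedge, egrp (peA h);
  erepP : forall h, peset h (erep h);
  erep_inv : forall h, gcast (egrp_inv (peA h)) (erep (pinv h)) = erep h;
  wB : forall h : pedge, vgrp (org (peB h));
  wC : forall h : pedge, vgrp (org (peC h));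
  vrep_org : forall h, vrep (porg h) =
    mV_at (org_at (peBA h)) (wB h) * tw_at (peBA h) * galpha (peA h) (erep h)
    * (tw_at (peCA h))^-1 * (mV_at (org_at (peCA h)) (wC h))^-1
}.

Lemma product_choice_exists : inhabited product_choice.
Proof.
pose vr (x : pvertex) : vgrp (pvA x) := xget 1 (pvset x).
have vrP x : pvset x (vr x).
  apply: xgetPex; have [a ->] := pvset_dcoset x.
  by exists a, 1, 1; rewrite !gmulf1 mul1g mulg1.
pose er (h : pedge) : egrp (peA h) := xget 1 (peset h).
have erP h : peset h (er h).
  apply: xgetPex; have [a ->] := peset_dcoset h.
  by exists a, 1, 1; rewrite !gmulf1 mul1g mulg1.
have er_inv h : gcast (egrp_inv (peA h)) (er (pinv h)) = er h.
  rewrite /er /= /pinv_set; move: (peset h) (egrp_inv (peA h)).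
  by move: (egrp (peA h)) => G S p; subst G; rewrite gcast_id.
have hw h : {bc : vgrp (org (peB h)) * vgrp (org (peC h)) |
    vr (porg h) = mV_at (org_at (peBA h)) bc.1 * tw_at (peBA h)
      * galpha (peA h) (er h)
      * (tw_at (peCA h))^-1 * (mV_at (org_at (peCA h)) bc.2)^-1}.
  apply: cid; have [a ea] := porg_dcoset h.
  have := vrP (porg h); rewrite /= ea.
  have : porg_set h (porg_elt (er h)).
    exists (er h); first exact: erP.
    by exists 1, 1; rewrite !gmulf1 mul1g mulg1.
  rewrite ea => -[b [c eh]] [b' [c' ->]].
  exists (b' * b^-1, c'^-1 * c) => /=.
  have -> : a = (mV_at (org_at (peBA h)) b)^-1 * porg_elt (er h)
      * (mV_at (org_at (peCA h)) c)^-1.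
    by rewrite eh -!mulgA mulKg mulgV mulg1.
  by rewrite /porg_elt !gmulfM !gmulfV invgM invgK !mulgA.
exact: (inhabits (@ProductChoice vr vrP er erP er_inv
  (fun h => (sval (hw h)).1) (fun h => (sval (hw h)).2)
  (fun h => svalP (hw h)))).
Qed.

Variable ch : product_choice.

Definition product_vgrp (x : pvertex) : groupType :=
  fibre_product (mV_at (pvBA x)) (mV_at (pvCA x)) (vrep ch x).

Definition product_egrp (h : pedge) : groupType :=
  fibre_product (mE_at (peBA h)) (mE_at (peCA h)) (erep ch h).

Lemma product_egrp_inv h : product_egrp (pinv h) = product_egrp h.
Proof.
symmetry; apply: (fibre_product_eq (pG := esym (egrp_inv (peB h)))
  (pH := esym (egrp_inv (peC h))) (pK := esym (egrp_inv (peA h)))).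
- by move=> x; rewrite -mE_at_inv.
- by move=> x; rewrite -mE_at_inv.
- by rewrite -(erep_inv ch h) (gcast_comp _ _ erefl) gcast_id.
Qed.

Definition product_alpha_val (h : pedge) (x : product_egrp h) :
    vgrp (org (peB h)) * vgrp (org (peC h)) :=
  (wB ch h * galpha (peB h) (val x).1 * (wB ch h)^-1,
   wC ch h * galpha (peC h) (val x).2 * (wC ch h)^-1).

Lemma product_alpha_subproof (h : pedge) (x : product_egrp h) :
  fibre (mV_at (org_at (peBA h))) (mV_at (org_at (peCA h))) (vrep ch (porg h))
    (product_alpha_val x).
Proof.
have ebc : mE_at (peBA h) (val x).1 ^ erep ch h = mE_at (peCA h) (val x).2.
  exact/eqP/(valP x).
apply/eqP; rewrite /product_alpha_val; move: (val x) ebc => [b c] ebc.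
change (mV_at (org_at (peBA h)) (wB ch h * galpha (peB h) b * (wB ch h)^-1)
  ^ vrep ch (porg h) =
  mV_at (org_at (peCA h)) (wC ch h * galpha (peC h) c * (wC ch h)^-1)).
have {}ebc : mE_at (peBA h) b ^ erep ch h = mE_at (peCA h) c := ebc.
rewrite vrep_org !gmulfM !gmulfV.
have := galpha_at (peCA h) c; rewrite -ebc gmulfJ galpha_at => e.
rewrite -[mV_at _ (galpha _ c)](conjgK (tw_at (peCA h))) -e.
by rewrite /conjg !invgM !invgK !mulgA !mulgVK.
Qed.

Definition product_alpha_fun (h : pedge) (x : product_egrp h) :
    product_vgrp (porg h) :=
  Subgrp _ (product_alpha_subproof x).

Lemma product_alpha_morph h : {morph @product_alpha_fun h : x y / x * y}.
Proof.
move=> x y; apply: val_inj; rewrite valM /= /product_alpha_val valM.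
by congr (_, _); rewrite /= gmulfM !mulgA mulgVK.
Qed.

Lemma product_alpha_inj h : injective (@product_alpha_fun h).
Proof.
move=> x y /(congr1 val) [/mulIg/mulgI/mono_inj e1 /mulIg/mulgI/mono_inj e2].
apply: val_inj.
by rewrite (surjective_pairing (val x)) e1 e2 -surjective_pairing.
Qed.

Definition product_alpha (h : pedge) :
    mono (product_egrp h) (product_vgrp (porg h)) :=
  mono_of (@product_alpha_morph h) (@product_alpha_inj h).

Definition product : graph_of_groups :=
  @GraphOfGroups product_graph product_vgrp product_egrp
    product_egrp_inv product_alpha.
End Product.

Arguments isomorphic K X Y : clear implicits.
Arguments is_pullback K {A B C P} muB muC rhoB rhoC.
Arguments has_pullback K {A B C} muB muC.

(* Main.v *)
From mathcomp Require Import all_boot boolp classical_sets.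
From mathcomp Require Import fingroup perm zmodp.
Require Import Defs.
Set Implicit Arguments.
Unset Strict Implicit.
Unset Printing Implicit Defensive.
Local Open Scope group_scope.

(** A commuting square over mB : B -> A and mC : C -> A, that is a pair of
    morphisms sB : X -> B, sC : X -> C with mB sB equivalent to mC sC, comes
    with witnesses a_v and a_f of that equivalence. The double cosets of the
    a_v and a_f are the vertices and edges of the product that correspond to
    those of X, so the witnesses tell how to map X to the product. But the
    equivalence only asserts that witnesses exist; other witnesses may give
    another map. So the product is a weak pullback: every commuting square
    factors through its projections, in general not uniquely
    ([product_weak_pullback]).

    Factoring is direct when every witness is the chosen representative of its
    double coset: the groups of the product are then made for the pairs
    (sB x, sC x), and the twisting elements are forced ([lift]). The general
    case is reduced to this one by replacing sB and sC by equivalent morphisms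
    ([conj_morphism], [equiv_via_conj]).

    If a pullback P exists, the universal property of P and the weak one of
    the product D give s : P -> D and t : D -> P over B and C, and t s is the
    identity by uniqueness. Then s is injective on vertices and edges. On
    vertex groups t is injective and t s is bijective, so s is surjective.
    Hence P is the subgraph of groups of D carried by the image of s
    ([retract_isomorphic]).

    To see that pullbacks may fail to exist, let B = C be a group G with one
    vertex, embedded by mu in a group K, and let an element a of K normalize
    mu G and induce an automorphism theta of G that is not inner. The squares
    (id, id) and (id, theta) both commute. If P were a pullback, squares on
    the trivial group would show that both factor through the same vertex of
    P. Since the map to B is already injective there, both factorizations
    agree up to conjugation in G, which would make theta inner
    ([no_pullback_outer]). An instance is the group of order 3 in its regular
    representation, where inversion is induced by a permutation. *)

(** * Transport of group elements *)

(** Together with unfolding [vcast] and [ecast], this brings every composite of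
    transports to a single [gcast], after which [gcast_irr] applies. *)
Lemma gcast_trans (G H K : groupType) (p : G = H) (q : H = K) x :
  gcast q (gcast p x) = gcast (etrans p q) x.
Proof. exact: gcast_comp. Qed.

Lemma galpha_ecastE (A : graph_of_groups) (e e' : edge A) (p : e = e') x :
  galpha e' (ecast p x) = vcast (f_equal (@org A) p) (galpha e x).
Proof. exact: galpha_ecast. Qed.

Lemma f_equal_trans (T U : Type) (F : T -> U) x y z (p : x = y) (q : y = z) :
  f_equal F (etrans p q) = etrans (f_equal F p) (f_equal F q).
Proof. exact: Prop_irrelevance. Qed.

(** * Fibre products *)

(** The groups D_h and D_(h^-1) are equal only by extensionality of their
    defining predicates; the transport along such an equality acts on each
    coordinate. *)
Lemma val_gcast_fibre (G G' H H' K K' : groupType)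
    (pG : G = G') (pH : H = H') (pK : K = K')
    (phi : mono G K) (psi : mono H K) (a : K)
    (phi' : mono G' K') (psi' : mono H' K') (a' : K')
    (p : fibre_product phi psi a = fibre_product phi' psi' a') x :
  (forall x, phi' (gcast pG x) = gcast pK (phi x)) ->
  (forall x, psi' (gcast pH x) = gcast pK (psi x)) ->
  a' = gcast pK a ->
  val (gcast p x) = (gcast pG (val x).1, gcast pH (val x).2).
Proof.
subst => /= ephi epsi ea; move: p x; rewrite /fibre_product.
have e : fibre phi psi a = fibre phi' psi' a'.
  by apply/funext => -[b c]; rewrite /fibre -ephi -epsi ea.
move: (fibre_closed phi' psi' a'); rewrite -e => cl p x.
have ecl := Prop_irrelevance (fibre_closed phi psi a) cl.
move: p; rewrite -ecl => p.
by rewrite gcast_id -surjective_pairing.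
Qed.

Section FibreProj.
Variables (G H K : groupType) (phi : mono G K) (psi : mono H K) (a : K).
Let D := fibre_product phi psi a.

Lemma fibreP (x : D) : phi (val x).1 ^ a = psi (val x).2.
Proof. exact/eqP/(valP x). Qed.

Lemma fibre_fst_morph : {morph (fun x : D => (val x).1) : x y / x * y}.
Proof. by move=> x y; rewrite valM. Qed.

Lemma fibre_snd_morph : {morph (fun x : D => (val x).2) : x y / x * y}.
Proof. by move=> x y; rewrite valM. Qed.

(** An element (b, c) satisfies phi b ^ a = psi c, so each coordinate
    determines the other. *)
Lemma fibre_fst_inj : injective (fun x : D => (val x).1).
Proof.
move=> x y e; apply: val_inj; move: (fibreP x) (fibreP y) e.
case: (val x) (val y) => b c [b' c'] /= + + e; rewrite e => ->.
by move/mono_inj => ->.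
Qed.

Lemma fibre_snd_inj : injective (fun x : D => (val x).2).
Proof.
move=> x y e; apply: val_inj; move: (fibreP x) (fibreP y) e.
case: (val x) (val y) => b c [b' c'] /= + + e; rewrite e => <-.
by move/conjg_inj/mono_inj => ->.
Qed.

Definition fibre_fst : mono D G := mono_of fibre_fst_morph fibre_fst_inj.
Definition fibre_snd : mono D H := mono_of fibre_snd_morph fibre_snd_inj.
End FibreProj.

Section Pairing.
Variables (G H K L : groupType) (phi : mono G K) (psi : mono H K) (r : K).
Variables (f : mono L G) (g : mono L H).
Hypothesis fg : forall x, fibre phi psi r (f x, g x).

Definition fibre_pair_fun x : fibre_product phi psi r := Subgrp _ (fg x).

Lemma fibre_pair_morph : {morph fibre_pair_fun : x y / x * y}.
Proof. by move=> x y; apply: val_inj; rewrite valM /= !gmulfM. Qed.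

Lemma fibre_pair_inj : injective fibre_pair_fun.
Proof. by move=> x y /(congr1 val) [/mono_inj]. Qed.

Definition fibre_pair : mono L (fibre_product phi psi r) :=
  mono_of fibre_pair_morph fibre_pair_inj.
End Pairing.

(** * The commuting square of the product *)

Section Projections.
Variables (A B C : graph_of_groups) (mB : morphism B A) (mC : morphism C A).
Variable ch : product_choice mB mC.

Lemma product_egrp_inv_val (h : pedge mB mC)
    (p : product_egrp ch (pinv h) = product_egrp ch h) x :
  val (gcast p x) =
    (gcast (egrp_inv (peB h)) (val x).1, gcast (egrp_inv (peC h)) (val x).2).
Proof.
apply: (val_gcast_fibre (pK := egrp_inv (peA h))).
- move=> b; apply: (@mono_inj _ _ (gcast (esym (egrp_inv (peA h))))).
  by rewrite -mE_at_inv !(gcast_comp _ _ erefl) !gcast_id.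
- move=> c; apply: (@mono_inj _ _ (gcast (esym (egrp_inv (peA h))))).
  by rewrite -mE_at_inv !(gcast_comp _ _ erefl) !gcast_id.
- by rewrite erep_inv.
Qed.

Lemma val_product_vcast (x x' : pvertex mB mC) (p : x = x')
    (q : product_vgrp ch x = product_vgrp ch x') y :
  val (gcast q y) = (vcast (f_equal (@pvB _ _ _ mB mC) p) (val y).1,
                     vcast (f_equal (@pvC _ _ _ mB mC) p) (val y).2).
Proof. by case: _ / p q => q; rewrite !gcast_id -surjective_pairing. Qed.

Lemma val_product_ecast (h h' : pedge mB mC) (p : h = h')
    (q : product_egrp ch h = product_egrp ch h') y :
  val (gcast q y) = (ecast (f_equal (@peB _ _ _ mB mC) p) (val y).1,
                     ecast (f_equal (@peC _ _ _ mB mC) p) (val y).2).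
Proof.
by case: _ / p q => q; rewrite /ecast !gcast_id -surjective_pairing.
Qed.


Definition projB_gm : gmorphism (product ch) B :=
  @GMorphism (product ch) B (@pvB _ _ _ mB mC) (@peB _ _ _ mB mC)
    (fun=> erefl) (fun=> erefl).

Definition projC_gm : gmorphism (product ch) C :=
  @GMorphism (product ch) C (@pvC _ _ _ mB mC) (@peC _ _ _ mB mC)
    (fun=> erefl) (fun=> erefl).

Definition projB : morphism (product ch) B.
Proof.
apply: (@morphism_of (product ch) B projB_gm (fun x => fibre_fst _ _ _)
  (fun h => fibre_fst _ _ _) (wB ch)) => h x.
- apply: (@mono_inj _ _ (gcast (egrp_inv (peB h)))).
  rewrite [RHS](gcast_comp _ _ erefl) gcast_id /=.
  have /(congr1 fst) /= <- := product_egrp_inv_val (product_egrp_inv ch h)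
     (gcast (esym (product_egrp_inv ch h)) x).
  by rewrite (gcast_comp _ _ erefl) gcast_id.
- by rewrite /= /product_alpha_val /= conjgE !mulgA mulVg mul1g mulgVK.
Defined.

Definition projC : morphism (product ch) C.
Proof.
apply: (@morphism_of (product ch) C projC_gm (fun x => fibre_snd _ _ _)
  (fun h => fibre_snd _ _ _) (wC ch)) => h x.
- apply: (@mono_inj _ _ (gcast (egrp_inv (peC h)))).
  rewrite [RHS](gcast_comp _ _ erefl) gcast_id /=.
  have /(congr1 snd) /= <- := product_egrp_inv_val (product_egrp_inv ch h)
     (gcast (esym (product_egrp_inv ch h)) x).
  by rewrite (gcast_comp _ _ erefl) gcast_id.
- by rewrite /= /product_alpha_val /= conjgE !mulgA mulVg mul1g mulgVK.
Defined.

(** The representatives of the double cosets witness the equivalence: the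
    defining equation of b_h and c_h is the one that [mequiv] asks for. *)
Lemma proj_square : mequiv (mor_comp mB projB) (mor_comp mC projC).
Proof.
exists (fun x => etrans (pvCA x) (esym (pvBA x))).
exists (fun h => etrans (peCA h) (esym (peBA h))).
exists (fun x => vcast (esym (pvBA x)) (vrep ch x)).
exists (fun h => ecast (esym (peBA h)) (erep ch h)).
split.
- move=> h; rewrite -[in RHS]erep_inv /ecast /= !gcast_trans.
  exact: gcast_irr.
- move=> x y; have /= := fibreP y => /(congr1 (vcast (esym (pvBA x)))).
  rewrite gmulfJ /vcast !gcast_trans gcast_id => ->; exact: gcast_irr.
- move=> h.
  (* The type annotation exposes the group law to rewriting: [vrep_org] is
     stated in the group of [pvA (porg h)]. *)
  have er : @eq (vgrp (org (peA h))) (vrep ch (porg h)) _ := vrep_org ch h.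
  apply: (etrans (congr1 (vcast (esym (org_at (peBA h)))) er)).
  rewrite /= /comp_tw /mV_at /tw_at /= !gmulfM !gmulfV /vcast !gcast_trans.
  rewrite galpha_ecastE /vcast gcast_trans invgM -!mulgA !gcast_id.
  by congr (_ * (_ * (_ * (_^-1 * _^-1)))); exact: gcast_irr.
Qed.
End Projections.

(** * Vertices and edges given by elements of double cosets *)

Section DoubleCosets.
Variables (G H K : groupType) (phi : mono G K) (psi : mono H K).

Lemma dcoset_id a : dcoset phi psi a a.
Proof. by exists 1, 1; rewrite !gmulf1 mul1g mulg1. Qed.

Lemma dcoset_mul a b c : dcoset phi psi (phi b * a * psi c) = dcoset phi psi a.
Proof.
apply/predeqP => k; split=> -[g [h ->]].
  by exists (g * b), (c * h); rewrite !gmulfM !mulgA.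
exists (g * b^-1), (c^-1 * h); rewrite !gmulfM !gmulfV !mulgA.
by rewrite mulgVK mulgK.
Qed.
End DoubleCosets.

Section ProductCells.
Variables (A B C : graph_of_groups).
Variables (mB : morphism B A) (mC : morphism C A).

Lemma pvertex_set_eq v w u (p : gmV mB v = u) (q : gmV mC w = u)
    (S S' : set (vgrp u)) (d : exists a, S = dcoset (mV_at p) (mV_at q) a)
    (d' : exists a, S' = dcoset (mV_at p) (mV_at q) a) :
  S = S' -> PVertex d = PVertex d'.
Proof. by move=> e; subst S'; rewrite (Prop_irrelevance d d'). Qed.

Lemma pedge_set_eq f g e (p : gmE mB f = e) (q : gmE mC g = e)
    (S S' : set (egrp e)) (d : exists a, S = dcoset (mE_at p) (mE_at q) a)
    (d' : exists a, S' = dcoset (mE_at p) (mE_at q) a) :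
  S = S' -> PEdge d = PEdge d'.
Proof. by move=> eS; subst S'; rewrite (Prop_irrelevance d d'). Qed.

Definition dcoset_vertex v w u (p : gmV mB v = u) (q : gmV mC w = u)
    (a : vgrp u) : pvertex mB mC :=
  PVertex (ex_intro _ a erefl : exists a', _ = dcoset (mV_at p) (mV_at q) a').

Definition dcoset_edge f g e (p : gmE mB f = e) (q : gmE mC g = e)
    (a : egrp e) : pedge mB mC :=
  PEdge (ex_intro _ a erefl : exists a', _ = dcoset (mE_at p) (mE_at q) a').

Lemma dcoset_vertex_eq v w u v' w' u' (p : gmV mB v = u) (q : gmV mC w = u)
    (p' : gmV mB v' = u') (q' : gmV mC w' = u') (r : u = u') a a' b c :
  v = v' -> w = w' -> a' = mV_at p' b * vcast r a * mV_at q' c ->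
  dcoset_vertex p q a = dcoset_vertex p' q' a'.
Proof.
move=> ev ew ->; subst v' w'; case: _ / r p' b q' c => p'.
rewrite (Prop_irrelevance p' p) => b q'.
rewrite (Prop_irrelevance q' q) => c.
by rewrite vcast_id; apply: pvertex_set_eq; rewrite dcoset_mul.
Qed.

Lemma dcoset_edge_eq f g e f' g' e' (p : gmE mB f = e) (q : gmE mC g = e)
    (p' : gmE mB f' = e') (q' : gmE mC g' = e') (r : e = e') a a' b c :
  f = f' -> g = g' -> a' = mE_at p' b * ecast r a * mE_at q' c ->
  dcoset_edge p q a = dcoset_edge p' q' a'.
Proof.
move=> ev ew ->; subst f' g'; case: _ / r p' b q' c => p'.
rewrite (Prop_irrelevance p' p) => b q'.
rewrite (Prop_irrelevance q' q) => c.
by rewrite /ecast gcast_id; apply: pedge_set_eq; rewrite dcoset_mul.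
Qed.

Lemma porg_dcoset_edge f g e (p : gmE mB f = e) (q : gmE mC g = e) a :
  porg (dcoset_edge p q a) =
  dcoset_vertex (org_at p) (org_at q) (tw_at p * galpha e a * (tw_at q)^-1).
Proof.
have e1 : @porg_set _ _ _ _ _ (dcoset_edge p q a) = dcoset (mV_at (org_at p))
    (mV_at (org_at q)) (tw_at p * galpha e a * (tw_at q)^-1).
  have [a0 e0] := porg_dcoset (dcoset_edge p q a).
  have : @porg_set _ _ _ _ _ (dcoset_edge p q a)
      (tw_at p * galpha e a * (tw_at q)^-1).
    by exists a; exact: dcoset_id.
  by rewrite e0 => -[b [c ->]]; rewrite dcoset_mul.
exact: pvertex_set_eq e1.
Qed.

Lemma pinv_dcoset_edge f g e (p : gmE mB f = e) (q : gmE mC g = e) a :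
  pinv (dcoset_edge p q a) =
  dcoset_edge (einv_at p) (einv_at q) (gcast (esym (egrp_inv e)) a).
Proof.
have e1 : @pinv_set _ _ _ _ _ (dcoset_edge p q a) = dcoset (mE_at (einv_at p))
    (mE_at (einv_at q)) (gcast (esym (egrp_inv e)) a).
  have [a0 e0] := pinv_dcoset (dcoset_edge p q a).
  have : @pinv_set _ _ _ _ _ (dcoset_edge p q a) (gcast (esym (egrp_inv e)) a).
    rewrite /pinv_set /= gcast_trans gcast_id; exact: dcoset_id.
  by rewrite e0 => -[b [c ->]]; rewrite dcoset_mul.
exact: pedge_set_eq e1.
Qed.
End ProductCells.

(** * Equivalences with explicit witnesses *)

Section Witnesses.
Variables B A : graph_of_groups.

(** The condition on the witnesses in [mequiv], which hides them: the map from
    a commuting square to the product depends on their choice. *)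
Definition equiv_via (m1 m2 : morphism B A)
    (pV : forall v, gmV m2 v = gmV m1 v)
    (a : forall v, vgrp (gmV m1 v)) (ae : forall f, egrp (gmE m1 f)) : Prop :=
  [/\ forall f, gcast (egrp_gm_inv m1 f) (ae (einv f)) = ae f,
      forall v x, vcast (pV v) (mV m2 v x) = mV m1 v x ^ a v
    & forall f, a (org f) =
        tw m1 f * vcast (gm_org m1 f) (galpha (gmE m1 f) (ae f))
        * (vcast (pV (org f)) (tw m2 f))^-1].

(** Conjugacy on edge groups follows from that on vertex groups, because
    boundary maps are injective and a_f relates the twisting elements. *)
Lemma equiv_via_edge (m1 m2 : morphism B A) pV a ae
    (pE : forall f, gmE m2 f = gmE m1 f) :
  @equiv_via m1 m2 pV a ae ->
  forall f x, ecast (pE f) (mE m2 f x) = mE m1 f x ^ ae f.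
Proof.
have eg : mgr m1 = mgr m2 by apply: gmorphism_eq.
case: m1 m2 eg pV pE a ae
  => g nV nE nt nH nH' [g2 nV2 nE2 nt2 nH2 nH2'] /= eg.
case: _ / eg nV2 nE2 nt2 nH2 nH2' => nV2 nE2 nt2 nH2 nH2' pV pE a ae.
case=> /= ca cV cE f x; rewrite /ecast gcast_id.
apply: (@mono_inj _ _ (galpha _)); apply: (@mono_inj _ _ (vcast (gm_org g _))).
rewrite !gmulfJ nH nH2 -conjgM.
have := cV (org f) (galpha f x); rewrite vcast_id => ->; rewrite -conjgM.
by rewrite cE vcast_id mulgVK.
Qed.
End Witnesses.

(** * Maps to the product *)

(** Here r is a representative of a double coset, written as b y z w^-1 c^-1 in
    two ways. The quotients of the outer factors are then an element of the
    fibre product over r; the right sides are bracketed as the witness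
    equations present them. *)
Lemma conj_div_of_eq (K : groupType) (r b b' y c c' z w : K) :
  r = b' * y * z / w / c' -> r = b * y * z / (c * w) ->
  (b / b') ^ r = c / c'.
Proof.
move=> e' e; rewrite conjgE {2}e' {1}e !invgM !invgK !mulgA.
by rewrite !mulgVK mulgK.
Qed.

Section Lift.
Variables (A B C X : graph_of_groups).
Variables (mB : morphism B A) (mC : morphism C A) (ch : product_choice mB mC).
Variables (sB : morphism X B) (sC : morphism X C).
Variables (pV : forall v, gmV (mor_comp mC sC) v = gmV (mor_comp mB sB) v).
Variables (pE : forall f, gmE (mor_comp mC sC) f = gmE (mor_comp mB sB) f).
Variables (a : forall v, vgrp (gmV (mor_comp mB sB) v)).
Variables (ae : forall f, egrp (gmE (mor_comp mB sB) f)).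
Hypothesis sq : equiv_via pV a ae.

Definition lift_vertex v : pvertex mB mC :=
  dcoset_vertex (v := gmV sB v) (w := gmV sC v) erefl (pV v) (a v).

Definition lift_edge f : pedge mB mC :=
  dcoset_edge (f := gmE sB f) (g := gmE sC f) erefl (pE f) (ae f).

(** The equation of [mequiv] for f says that a_(o(f)) lies in the double coset
    that is the origin of the double coset of a_f. *)
Lemma lift_org f : porg (lift_edge f) = lift_vertex (org f).
Proof.
have [_ _ cE] := sq; rewrite porg_dcoset_edge.
apply: (@dcoset_vertex_eq _ _ _ mB mC _ _ _ _ _ _ _ _ _ _
  (gm_comp_org mB sB f) _ _ (tw sB f) (tw sC f)^-1
  (gm_org sB f) (gm_org sC f)).
rewrite cE /= /comp_tw /mV_at /tw_at /= !gmulfM !gmulfV /vcast !gcast_trans.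
rewrite invgM !mulgA.
by congr (_ * _ * _ / _ / _); exact: gcast_irr.
Qed.

Lemma lift_inv f : lift_edge (einv f) = pinv (lift_edge f).
Proof.
have [ca _ _] := sq; rewrite pinv_dcoset_edge; symmetry.
apply: (@dcoset_edge_eq _ _ _ mB mC _ _ _ _ _ _ _ _ _ _
  (esym (gm_comp_inv mB sB f)) _ _ 1 1
  (esym (gm_inv sB f)) (esym (gm_inv sC f))).
rewrite !gmulf1 mul1g mulg1 -[in RHS]ca /ecast !gcast_trans.
exact: esym (gcast_id _ _).
Qed.

Definition lift_gm : gmorphism X (product ch) :=
  @GMorphism X (product ch) lift_vertex lift_edge lift_org lift_inv.

(** Under these two hypotheses sB x and sC x are paired by the fibre products
    as they stand, without conjugation. *)
Hypothesis vrep_lift :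
  forall v, vrep ch (lift_vertex v) = a v :> vgrp (gmV mB (gmV sB v)).
Hypothesis erep_lift :
  forall f, erep ch (lift_edge f) = ae f :> egrp (gmE mB (gmE sB f)).

Lemma lift_mV_fibre v x :
  fibre (mV_at (pvBA (lift_vertex v))) (mV_at (pvCA (lift_vertex v)))
    (vrep ch (lift_vertex v)) (mV sB v x, mV sC v x).
Proof.
have [_ cV _] := sq; apply/eqP; have /= := cV v x.
by rewrite -vrep_lift => ->.
Qed.

Lemma lift_mE_fibre f x :
  fibre (mE_at (peBA (lift_edge f))) (mE_at (peCA (lift_edge f)))
    (erep ch (lift_edge f)) (mE sB f x, mE sC f x).
Proof.
apply/eqP; have /= := equiv_via_edge pE sq x.
by rewrite -erep_lift => ->.
Qed.

(** A second expression of a_(o(f)), through b_h and c_h in place of the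
    twisting elements of sB and sC. *)
Lemma vrep_lift_org f :
  a (org f) =
  mV mB _ (vcast (gm_org sB f) (wB ch (lift_edge f)))
  * vcast (f_equal (gmV mB) (gm_org sB f)) (tw mB (gmE sB f))
  * vcast (gm_org (mor_comp mB sB) f) (galpha _ (ae f))
  / vcast (etrans (f_equal (gmV mC) (gm_org sC f)) (pV (org f)))
      (tw mC (gmE sC f))
  / vcast (pV (org f)) (mV mC _ (vcast (gm_org sC f) (wC ch (lift_edge f)))).
Proof.
rewrite -vrep_lift.
rewrite -(gcast_section (fun x => vrep ch x) (lift_org f)
   (f_equal (@vgrp A) (gm_comp_org mB sB f))).
have er : @eq (vgrp (org (gmE mB (gmE sB f)))) (vrep ch (porg (lift_edge f))) _
  := vrep_org ch (lift_edge f).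
apply: (etrans (congr1 (vcast (gm_comp_org mB sB f)) er)).
rewrite -erep_lift !mV_vcast /mV_at /tw_at /= !gmulfM !gmulfV /vcast.
rewrite !gcast_trans.
by congr (_ * _ * _ / _ / _); exact: gcast_irr.
Qed.

(** The projection of the product has b_h as twisting element on the edge h, so
    the first coordinate of the twisting element of the lift must be the
    quotient of that of sB by b_h; similarly for the second. *)
Lemma lift_tw_fibre f :
  fibre (mV_at (pvBA (lift_vertex (org f))))
    (mV_at (pvCA (lift_vertex (org f))))
    (vrep ch (lift_vertex (org f)))
    (tw sB f * (vcast (gm_org sB f) (wB ch (lift_edge f)))^-1,
     tw sC f * (vcast (gm_org sC f) (wC ch (lift_edge f)))^-1).
Proof.
apply/eqP; have [_ _ cE] := sq; have := cE f.
rewrite vrep_lift /= /comp_tw /= !gmulfM !gmulfV.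
have := vrep_lift_org f; rewrite /vcast !gcast_trans !f_equal_trans.
exact: conj_div_of_eq.
Qed.

Definition lift_mV v : mono (vgrp v) (product_vgrp ch (lift_vertex v)) :=
  fibre_pair (@lift_mV_fibre v).

Definition lift_mE f : mono (egrp f) (product_egrp ch (lift_edge f)) :=
  fibre_pair (@lift_mE_fibre f).

Definition lift_tw f : product_vgrp ch (lift_vertex (org f)) :=
  Subgrp _ (lift_tw_fibre f).

Definition lift : morphism X (product ch).
Proof.
apply: (@morphism_of X (product ch) lift_gm lift_mV lift_mE lift_tw).
- move=> f x; apply: (@mono_inj _ _ (gcast (egrp_gm_inv lift_gm f))).
  rewrite [RHS]gcast_trans gcast_id /egrp_gm_inv -gcast_trans.
  apply: val_inj.
  rewrite product_egrp_inv_val (val_product_ecast (lift_inv f)) /=.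
  rewrite (mE_inv _ (esym (egrp_gm_inv sB f))).
  rewrite (mE_inv _ (esym (egrp_gm_inv sC f))).
  by rewrite /ecast !gcast_trans !gcast_id.
- move=> f x; apply: val_inj.
  rewrite [LHS](val_product_vcast (lift_org f)).
  transitivity
    (mV sB _ (galpha f x) ^
       (tw sB f * (vcast (gm_org sB f) (wB ch (lift_edge f)))^-1),
     mV sC _ (galpha f x) ^
       (tw sC f * (vcast (gm_org sC f) (wC ch (lift_edge f)))^-1)); last by [].
  rewrite /= !conjgM -!m_alpha !(conjgE _ _^-1) !invgK !mulgA.
  rewrite !gmulfM !gmulfV /vcast.
  by congr (_ * _ / _, _ * _ / _); exact: gcast_irr.
Defined.

Lemma projB_lift : mequiv (mor_comp (projB ch) lift) sB.
Proof.
apply: (@mequiv_pointwise _ _ (mor_comp (projB ch) lift) sB (fun=> erefl))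
  => // f.
rewrite vcast_id /= /comp_tw /=.
rewrite -[LHS](mulgVK (vcast (gm_org sB f) (wB ch (lift_edge f)))).
by congr (_ * _); exact: gcast_irr.
Qed.

Lemma projC_lift : mequiv (mor_comp (projC ch) lift) sC.
Proof.
apply: (@mequiv_pointwise _ _ (mor_comp (projC ch) lift) sC (fun=> erefl))
  => // f.
rewrite vcast_id /= /comp_tw /=.
rewrite -[LHS](mulgVK (vcast (gm_org sC f) (wC ch (lift_edge f)))).
by congr (_ * _); exact: gcast_irr.
Qed.
End Lift.

(** * Changing a morphism within its class *)

Section ConjMono.
Variables (G : groupType) (g : G).

Definition mono_conj : mono G G :=
  @mono_of G G (fun x => x ^ g) (fun x y => conjMg x y g) (@conjg_inj G g).
End ConjMono.

Section ConjMorphism.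
Variables (B A : graph_of_groups) (m : morphism B A).
Variables (b : forall v, vgrp (gmV m v)) (be : forall f, egrp (gmE m f)).
Hypothesis be_inv : forall f, gcast (egrp_gm_inv m f) (be (einv f)) = be f.

(** The twisting elements are those that make b and be witnesses of the
    equivalence with m. *)
Definition conj_morphism : morphism B A.
Proof.
apply: (@morphism_of B A m (fun v => mono_comp (mono_conj (b v)) (mV m v))
  (fun f => mono_comp (mono_conj (be f)) (mE m f))
  (fun f => (b (org f))^-1 * tw m f * vcast (gm_org m f) (galpha _ (be f)))).
- move=> f x /=; rewrite -[be f]be_inv (mE_inv _ (esym (egrp_gm_inv m f))).
  by rewrite gmulfJ gcast_trans gcast_id.
- by move=> f x /=; rewrite !gmulfJ m_alpha -!conjgM !mulgA mulgV mul1g.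
Defined.

Lemma mequiv_conj : mequiv m conj_morphism.
Proof.
exists (fun=> erefl), (fun=> erefl), b, be; split=> //= f.
by rewrite !invgM invgK !mulgA mulgK mulgV mul1g.
Qed.
End ConjMorphism.

Lemma tw_comp_conj (C B A : graph_of_groups) (n : morphism B A)
    (m : morphism C B) b be (be_inv : forall f, _) f :
  tw (mor_comp n (@conj_morphism _ _ m b be be_inv)) f =
  (mV n _ (b (org f)))^-1 * tw (mor_comp n m) f
  * vcast (gm_org (mor_comp n m) f) (galpha _ (mE n _ (be f))).
Proof.
rewrite /= /comp_tw /=.
have <- : vcast (f_equal (gmV n) (gm_org m f))
    (vcast (gm_org n _) (galpha (gmE n (gmE m f)) (mE n _ (be f)))) =
    vcast (gm_comp_org n m f) (galpha _ (mE n _ (be f))) by exact: gcast_comp.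
by rewrite m_alpha !gmulfM !gmulfV mV_vcast !mulgA mulgK.
Qed.

Lemma mE_comp_inv (C B A : graph_of_groups) (n : morphism B A)
    (m : morphism C B) f
    (r : egrp (gmE n (gmE m (einv f))) = egrp (gmE n (gmE m f))) x :
  gcast r (mE n _ x) = mE n _ (gcast (egrp_gm_inv m f) x).
Proof. by symmetry; apply: mE_inv_cast; exact: gm_inv. Qed.

Section ChangeWitness.
Variables (A B C X : graph_of_groups).
Variables (mB : morphism B A) (mC : morphism C A).
Variables (sB : morphism X B) (sC : morphism X C).
Variables (pV : forall v, gmV (mor_comp mC sC) v = gmV (mor_comp mB sB) v).
Variables (pE : forall f, gmE (mor_comp mC sC) f = gmE (mor_comp mB sB) f).
Variables (a : forall v, vgrp (gmV (mor_comp mB sB) v)).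
Variables (ae : forall f, egrp (gmE (mor_comp mB sB) f)).
Hypothesis sq : equiv_via pV a ae.
Variables (b : forall v, vgrp (gmV sB v)) (be : forall f, egrp (gmE sB f)).
Variables (c : forall v, vgrp (gmV sC v)) (ce : forall f, egrp (gmE sC f)).
Hypothesis be_inv : forall f, gcast (egrp_gm_inv sB f) (be (einv f)) = be f.
Hypothesis ce_inv : forall f, gcast (egrp_gm_inv sC f) (ce (einv f)) = ce f.

(** Conjugating sB and sC moves each witness inside its double coset, to the
    place that b and c prescribe. *)
Lemma equiv_via_conj :
  @equiv_via _ _ (mor_comp mB (conj_morphism b be_inv))
    (mor_comp mC (conj_morphism c ce_inv)) pV
    (fun v => (mV mB _ (b v))^-1 * a v * vcast (pV v) (mV mC _ (c v)))
    (fun f => (mE mB _ (be f))^-1 * ae f * ecast (pE f) (mE mC _ (ce f))).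
Proof.
have [ca cV cE] := sq; split.
- move=> f; rewrite !gmulfM gmulfV; congr (_^-1 * _ * _).
  + rewrite -[be f]be_inv; exact: mE_comp_inv.
  + exact: ca.
  + rewrite -[ce f]ce_inv -(mE_comp_inv (egrp_gm_inv (mor_comp mC sC) f)).
    rewrite /ecast !gcast_trans; exact: gcast_irr.
- move=> v x; rewrite /= !gmulfJ; have /= -> := cV v x.
  by rewrite -!conjgM !mulgA mulgV mul1g.
- move=> f; rewrite !tw_comp_conj cE.
  rewrite !gmulfM !gmulfV galpha_ecastE.
  have -> z : vcast (gm_org (mor_comp mB (conj_morphism b be_inv)) f) z =
      vcast (gm_org (mor_comp mB sB) f) z by exact: gcast_irr.
  have -> z : vcast (gm_org (mor_comp mB sB) f)
      (vcast (f_equal (@org A) (pE f)) z) =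
      vcast (pV (org f)) (vcast (gm_org (mor_comp mC sC) f) z).
    by rewrite /vcast !gcast_trans; exact: gcast_irr.
  by rewrite !invgM !invgK !mulgA !mulgK.
Qed.
End ChangeWitness.

(** * The product is a weak pullback *)

(** The arbitrary choice [xget] is stable under transport. Choosing with it
    makes the elements attached to f and to f^-1 agree, with no orientation of
    the graph. *)
Lemma xget_gcast (G G' H H' : groupType) (p : G = G') (q : H = H')
    (Q : set (G * H)) (Q' : set (G' * H')) :
  (forall x, Q x <-> Q' (gcast p x.1, gcast q x.2)) ->
  (gcast p (xget 1 Q).1, gcast q (xget 1 Q).2) = xget 1 Q'.
Proof.
subst => QQ'; have <- : Q = Q'.
  by apply/predeqP => -[x y]; rewrite QQ' !gcast_id.
by rewrite !gcast_id -surjective_pairing.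
Qed.

Section WeakPullback.
Variables (A B C X : graph_of_groups).
Variables (mB : morphism B A) (mC : morphism C A) (ch : product_choice mB mC).
Variables (sB : morphism X B) (sC : morphism X C).

Lemma vrep_dcoset_mul v w u (p : gmV mB v = u) (q : gmV mC w = u) a b c :
  vrep ch (dcoset_vertex p q (mV_at p b * a * mV_at q c)) =
  vrep ch (dcoset_vertex p q a) :> vgrp u.
Proof.
rewrite /dcoset_vertex; move: (ex_intro _ a _) (ex_intro _ (_ * _) _).
rewrite dcoset_mul => d d'; by rewrite (Prop_irrelevance d d').
Qed.

Lemma erep_dcoset_mul f g e (p : gmE mB f = e) (q : gmE mC g = e) a b c :
  erep ch (dcoset_edge p q (mE_at p b * a * mE_at q c)) =
  erep ch (dcoset_edge p q a) :> egrp e.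
Proof.
rewrite /dcoset_edge; move: (ex_intro _ a _) (ex_intro _ (_ * _) _).
rewrite dcoset_mul => d d'; by rewrite (Prop_irrelevance d d').
Qed.

(** The chosen representative of the double coset of a_v is
    mB(b) a_v mC(c) for some b and c; conjugating sB by b^-1 and sC by c makes
    it the new witness. Edges are treated alike, with b and c chosen equal on f
    and f^-1. The new witnesses have the same double cosets, hence the same
    representatives, as the old ones. *)
Lemma product_weak_pullback :
  mequiv (mor_comp mB sB) (mor_comp mC sC) ->
  exists s : morphism X (product ch),
    mequiv (mor_comp (projB ch) s) sB /\ mequiv (mor_comp (projC ch) s) sC.
Proof.
case=> pV [pE [a [ae sq]]].
pose QV v : set (vgrp (gmV sB v) * vgrp (gmV sC v)) :=
  fun bc => vrep ch (lift_vertex pV a v) =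
    mV mB _ bc.1 * a v * vcast (pV v) (mV mC _ bc.2)
     :> vgrp (gmV (mor_comp mB sB) v).
pose QE f : set (egrp (gmE sB f) * egrp (gmE sC f)) :=
  fun bc => erep ch (lift_edge pE ae f) =
    mE mB _ bc.1 * ae f * ecast (pE f) (mE mC _ bc.2)
     :> egrp (gmE (mor_comp mB sB) f).
have QVx v : QV v (xget 1 (QV v)).
  have [b [c e]] := vrepP ch (lift_vertex pV a v).
  by apply: xgetPex; exists (b, c).
have QEx f : QE f (xget 1 (QE f)).
  have [b [c e]] := erepP ch (lift_edge pE ae f).
  by apply: xgetPex; exists (b, c).
have QE_inv f : (gcast (egrp_gm_inv sB f) (xget 1 (QE (einv f))).1,
    gcast (egrp_gm_inv sC f) (xget 1 (QE (einv f))).2) = xget 1 (QE f).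
  apply: xget_gcast => -[b c].
  have [ca _ _] := sq.
  pose R := egrp_gm_inv (mor_comp mB sB) f.
  have e1 : gcast R (erep ch (lift_edge pE ae (einv f))) =
      erep ch (lift_edge pE ae f).
    rewrite -(erep_inv ch (lift_edge pE ae f)).
    rewrite -(gcast_section (fun h => erep ch h) (lift_inv pE sq f)
      (f_equal (@egrp A) (gm_comp_inv mB sB f))).
    by rewrite gcast_trans; exact: gcast_irr.
  have e2 :
    gcast R (mE mB _ b * ae (einv f) * ecast (pE (einv f)) (mE mC _ c)) =
    mE mB _ (gcast (egrp_gm_inv sB f) b) * ae f
      * ecast (pE f) (mE mC _ (gcast (egrp_gm_inv sC f) c)).
    rewrite !gmulfM; congr (_ * _ * _).
    - exact: mE_comp_inv.
    - exact: ca.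
    - rewrite -(mE_comp_inv (egrp_gm_inv (mor_comp mC sC) f)).
      rewrite /ecast !gcast_trans; exact: gcast_irr.
  rewrite /QE /= -e1 -e2; split=> [->|/mono_inj] //.
pose b v := (xget 1 (QV v)).1^-1; pose c v := (xget 1 (QV v)).2.
pose be f := (xget 1 (QE f)).1^-1; pose ce f := (xget 1 (QE f)).2.
have be_inv f : gcast (egrp_gm_inv sB f) (be (einv f)) = be f.
  by rewrite /be -[in RHS]QE_inv gmulfV.
have ce_inv f : gcast (egrp_gm_inv sC f) (ce (einv f)) = ce f.
  by rewrite /ce -[in RHS]QE_inv.
have sq' : equiv_via _ _ _ := equiv_via_conj pE sq b c be_inv ce_inv.
set a' := fun v => (mV mB _ (b v))^-1 * _ * _ in sq'.
set ae' := fun f => (mE mB _ (be f))^-1 * _ * _ in sq'.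
have vl v : vrep ch (lift_vertex (sB := conj_morphism b be_inv)
   (sC := conj_morphism c ce_inv) pV a' v) = a' v :> vgrp (gmV mB (gmV sB v)).
  have ea : a' v = mV mB _ (xget 1 (QV v)).1 * a v
      * vcast (pV v) (mV mC _ (xget 1 (QV v)).2).
    by rewrite /a' /b gmulfV invgK.
  rewrite /lift_vertex ea -[RHS]QVx.
  exact: (@vrep_dcoset_mul (gmV sB v) (gmV sC v) _ erefl (pV v)).
have el f : erep ch (lift_edge (sB := conj_morphism b be_inv)
   (sC := conj_morphism c ce_inv) pE ae' f) = ae' f :> egrp (gmE mB (gmE sB f)).
  have ea : ae' f = mE mB _ (xget 1 (QE f)).1 * ae f
      * ecast (pE f) (mE mC _ (xget 1 (QE f)).2).
    by rewrite /ae' /be gmulfV invgK.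
  rewrite /lift_edge ea -[RHS]QEx.
  exact: (@erep_dcoset_mul (gmE sB f) (gmE sC f) _ erefl (pE f)).
exists (lift sq' vl el); split.
- apply: mequiv_trans (projB_lift _ _ _) _; exact/mequiv_sym/mequiv_conj.
- apply: mequiv_trans (projC_lift _ _ _) _; exact/mequiv_sym/mequiv_conj.
Qed.
End WeakPullback.

(** * Retracts are subgraphs of groups *)

(** Witnesses over X are transported to Y along the bijections. As [mequiv]
    constrains only the maps on vertex groups and the twisting elements,
    surjectivity on vertex groups makes them witnesses over Y. *)
Lemma epi_of_bijective (Y X W : graph_of_groups) (f : morphism X Y)
    (n1 n2 : morphism Y W) :
  injective (gmV f) -> (forall w, exists v, gmV f v = w) ->
  injective (gmE f) -> (forall h, exists e, gmE f e = h) ->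
  (forall v y, exists x, mV f v x = y) ->
  mequiv (mor_comp n1 f) (mor_comp n2 f) -> mequiv n1 n2.
Proof.
move=> fVi fVs fEi fEs fs [pV [pE [a [ae [ca cV cE]]]]].
have eg : mgr n1 = mgr n2.
  by apply: gmorphism_eq => w; [have [v <-] := fVs w; have /= -> := pV v
    | have [e <-] := fEs w; have /= -> := pE e].
case: n1 n2 eg pV pE a ae ca cV cE
  => g nV nE nt nH nH' [g2 nV2 nE2 nt2 nH2 nH2'] /= eg.
case: _ / eg nV2 nE2 nt2 nH2 nH2' => nV2 nE2 nt2 nH2 nH2' pV pE a ae ca cV cE.
pose iV w := projT1 (cid (fVs w)).
have iVK w : gmV f (iV w) = w by rewrite /iV; case: cid.
pose iE h := projT1 (cid (fEs h)).
have iEK h : gmE f (iE h) = h by rewrite /iE; case: cid.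
pose b w : vgrp (gmV g w) := vcast (f_equal (gmV g) (iVK w)) (a (iV w)).
pose be h : egrp (gmE g h) := ecast (f_equal (gmE g) (iEK h)) (ae (iE h)).
have bE v : b (gmV f v) = a v.
  rewrite /b; move: (iVK _) => p; exact: (gcast_section a (fVi _ _ p)).
have beE e : be (gmE f e) = ae e.
  rewrite /be; move: (iEK _) => p; exact: (gcast_section ae (fEi _ _ p)).
apply: mequiv_same; exists b, be; split=> /= [h|w y|h].
- have [e <-] := fEs h; rewrite beE -ca /= -(beE (einv e)).
  have k : einv (gmE f e) = gmE f (einv e) by rewrite gm_inv.
  rewrite -(gcast_section be k (f_equal (fun e => egrp (gmE g e)) k)).
  by symmetry; exact: gcast_comp.
- have [v ew] := fVs w; subst w; have [x <-] := fs v y.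
  by have := cV v x; rewrite vcast_id bE.
- have [e eh] := fEs h; subst h; have [x ex] := fs (org e) (tw f e).
  apply: (@mono_inj _ _ (vcast (f_equal (gmV g) (gm_org f e)))).
  rewrite (gcast_section b (gm_org f e)) bE !gmulfM !gmulfV beE.
  have -> z : vcast (f_equal (gmV g) (gm_org f e)) (vcast (gm_org g _) z) =
      vcast (gm_comp_org g f e) z by exact: gcast_comp.
  have := cE e; have := cV (org e) x.
  rewrite !vcast_id /comp_tw /= -ex => -> ea.
  apply: (@mulgI _ (nV _ (mV f _ x))); rewrite !mulgA.
  apply: (@mulIg _ (vcast (f_equal (gmV g) (gm_org f e)) (nt2 (gmE f e)))).
  rewrite mulgVK (conjgC _ (a (org e))) -[LHS]mulgA {1}ea.
  by rewrite mulgVK.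
Qed.

Section Retract.
Variables (X D : graph_of_groups) (s : morphism X D) (t : morphism D X).
Hypothesis ts : mequiv (mor_comp t s) (mor_id X).

Lemma retract_gmV v : gmV t (gmV s v) = v.
Proof. by have [pV _] := ts; exact: esym (pV v). Qed.

Lemma retract_gmE f : gmE t (gmE s f) = f.
Proof. by have [_ [pE _]] := ts; exact: esym (pE f). Qed.

(** The element t y equals t (s x) for some x since t s is an inner automorphism
    on vertex groups, and t is injective. *)
Lemma retract_mV_surj v y : exists x, mV s v x = y.
Proof.
have [pV [_ [a [_ [_ cV _]]]]] := ts.
exists (vcast (esym (pV v)) (mV t _ y ^ a v)).
apply: (@mono_inj _ _ (mV t _)); apply: (@conjg_inj _ (a v)).
by rewrite -cV /= [LHS](gcast_comp _ _ erefl).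
Qed.

Definition image_subgraph : subgraph D.
Proof.
exists (range (gmV s)) (range (gmE s)) => _ [f _ <-].
- by exists (org f); rewrite // gm_org.
- by exists (einv f); rewrite // gm_inv.
Defined.

Definition subgraph_incl_gm (S : subgraph D) :
    gmorphism (sub_graph_of_groups S) D :=
  @GMorphism (sub_graph_of_groups S) D sval sval (fun=> erefl) (fun=> erefl).

Definition subgraph_incl (S : subgraph D) : morphism (sub_graph_of_groups S) D.
Proof.
apply: (@morphism_of (sub_graph_of_groups S) D (subgraph_incl_gm S)
  (fun v => mono_id _) (fun e => mono_id _) (fun e => 1)).
- move=> f x; exact: gcast_irr.
- by move=> f x; rewrite conjg1.
Defined.

Let S := image_subgraph.

Definition image_gmV v : vertex (sub_graph_of_groups S) :=
  exist _ (gmV s v) (ex_intro2 _ _ v I erefl).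
Definition image_gmE f : edge (sub_graph_of_groups S) :=
  exist _ (gmE s f) (ex_intro2 _ _ f I erefl).

Lemma image_gm_org f : org (image_gmE f) = image_gmV (org f).
Proof. by apply: eq_exist; rewrite /= gm_org. Qed.

Lemma image_gm_inv f : image_gmE (einv f) = einv (image_gmE f).
Proof. by apply: eq_exist; rewrite /= gm_inv. Qed.

Definition image_gm : gmorphism X (sub_graph_of_groups S) :=
  GMorphism image_gm_org image_gm_inv.

Definition corestriction : morphism X (sub_graph_of_groups S).
Proof.
apply: (@morphism_of X (sub_graph_of_groups S) image_gm (mV s) (mE s) (tw s)).
- move=> f x; rewrite (mE_inv _ (esym (egrp_gm_inv s f))); exact: gcast_irr.
- move=> f x; rewrite -m_alpha; exact: gcast_irr.
Defined.

Lemma incl_corestriction : mequiv (mor_comp (subgraph_incl S) corestriction) s.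
Proof.
apply: (@mequiv_pointwise _ _ (mor_comp (subgraph_incl S) corestriction) s
  (fun=> erefl)) => // f.
by rewrite vcast_id /= /comp_tw /= gmulf1 mulg1.
Qed.

(** The restriction of t is a left inverse of the corestriction of s, which is
    an epimorphism, so it is also a right inverse. *)
Lemma retract_isomorphic :
  isomorphic GrGp X (sub_graph_of_groups image_subgraph).
Proof.
exists (mclass corestriction), (mclass (mor_comp t (subgraph_incl S))).
have left : mequiv
    (mor_comp (mor_comp t (subgraph_incl S)) corestriction) (mor_id X).
  apply: mequiv_trans ts; apply: mequiv_trans (mequiv_sym (mor_compA _ _ _)) _.
  exact: mequiv_comp (mequiv_refl _) incl_corestriction.
split; rewrite /= arrow_compE; apply/mclass_eq => //.
apply: (@epi_of_bijective _ _ _ corestriction).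
- by move=> v w /(congr1 (gmV t \o sval)) /=; rewrite !retract_gmV.
- by case=> w hw; have [v _ ev] := hw; exists v; apply: eq_exist.
- by move=> v w /(congr1 (gmE t \o sval)) /=; rewrite !retract_gmE.
- by case=> w hw; have [v _ ev] := hw; exists v; apply: eq_exist.
- exact: retract_mV_surj.
- apply: mequiv_trans (mequiv_sym (mor_compA _ _ _)) _.
  apply: mequiv_trans (mequiv_sym (mor_comp1l _)).
  apply: mequiv_trans (mor_comp1r _).
  exact: mequiv_comp (mequiv_refl _) left.
Qed.
End Retract.

(** * Outer automorphisms obstruct pullbacks *)

Section GroupAsGraph.

Definition point_graph : graph :=
  @Graph unit void (fun e => match e with end) (fun e => e)
    (fun e => match e with end) (fun e => match e with end).

Definition group_gog (G : groupType) : graph_of_groups :=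
  @GraphOfGroups point_graph (fun=> G) (fun=> G)
    (fun e => match e with end) (fun e => match e with end).

Variables G H : groupType.

Lemma gog_vcast (u u' : vertex (group_gog G)) (p : u = u') x :
  vcast p x = x :> G.
Proof. exact: gcast_id. Qed.

Definition group_mor (f : mono G H) : morphism (group_gog G) (group_gog H) :=
  @Morphism (group_gog G) (group_gog H) (gm_id point_graph) (fun=> f)
    (fun e => match e with end) (fun e => match e with end)
    (fun e => match e with end) (fun e => match e with end).
End GroupAsGraph.

Lemma mequiv_group_comp (G H K : groupType) (g : mono H K) (f : mono G H)
    (h : mono G K) a :
  (forall x, h x = g (f x) ^ a) ->
  mequiv (mor_comp (group_mor g) (group_mor f)) (group_mor h).
Proof.
move=> e; exists (fun=> erefl), (fun e : void => match e with end), (fun=> a),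
  (fun e : void => match e with end).
by split=> // -[].
Qed.

Lemma mequiv_vertex (P : graph_of_groups) (G H : groupType)
    (r : morphism P (group_gog H)) (s : morphism (group_gog G) P)
    (f : mono G H) :
  mequiv (mor_comp r s) (group_mor f) ->
  exists a : H, forall x, f x = mV r _ (mV s tt x) ^ a.
Proof.
case=> pV [_ [a [_ [_ cV _]]]]; exists (a tt) => x.
rewrite -[LHS](gog_vcast (pV tt)); exact: cV.
Qed.

Section Outer.
Variables (G K : groupType) (mu : mono G K) (theta : mono G G) (a : K).
Hypothesis theta_conj : forall x, mu (theta x) = mu x ^ a.

(** The twisted square (id, theta) and the square (id, id) factor through the
    same vertex group of P, where the map to B makes the factorizations m1 and
    m2 conjugate in G; comparing their images in C, theta is inner. *)
Lemma no_pullback_outer : (forall c, exists x, theta x <> x ^ c) ->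
  ~ has_pullback GrGp (mclass (group_mor mu)) (mclass (group_mor mu)).
Proof.
move=> outer [P [rB [rC [/= _ univ]]]].
have [rB' eB] := mclassP rB; have [rC' eC] := mclassP rC; subst rB rC.
have square (L : groupType) (f g : mono L G) b :
    (forall x, mu (g x) = mu (f x) ^ b) ->
    exists! s, arrow_comp (mclass rB') s = mclass (group_mor f) /\
               arrow_comp (mclass rC') s = mclass (group_mor g).
  move=> fg; apply: univ; rewrite !arrow_compE; apply/mclass_eq.
  apply: (@mequiv_trans _ _ _ (group_mor (mono_comp mu g))).
    exact: (@mequiv_group_comp _ _ _ _ _ _ b).
  by apply/mequiv_sym/(@mequiv_group_comp _ _ _ _ _ _ 1) => x; rewrite conjg1.
have [s1 [[s1B s1C] _]] := square G (mono_id G) (mono_id G) 1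
  (fun x => esym (conjg1 _)).
have [s2 [[s2B s2C] _]] := square G (mono_id G) theta a theta_conj.
have [t1 e1] := mclassP s1; have [t2 e2] := mclassP s2; subst s1 s2.
(* Squares on the trivial group factor uniquely, and they have the same
   components in B and C whether they come from t1 or t2. *)
have one_morph : {morph (fun=> 1 : G) : x y / (x : 'I_1) * y >-> x * y}.
  by move=> x y; rewrite mulg1.
have one_inj : injective (fun _ : 'I_1 => 1 : G).
  by move=> x y _; rewrite !ord1.
pose o := mono_of one_morph one_inj.
have [t [_ tuniq]] := square _ o o 1 (fun x => esym (conjg1 _)).
have vertexE : gmV t1 tt = gmV t2 tt.
  have /mclass_eq [pV _] : mclass (mor_comp t2 (group_mor o)) =
      mclass (mor_comp t1 (group_mor o)).
    rewrite -!arrow_compE.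
    rewrite -(tuniq (arrow_comp (mclass t1) (mclass (group_mor o)))).
      apply/esym/tuniq.
      rewrite !arrow_compA s2B s2C !arrow_compE; split; apply/mclass_eq.
        by apply: (@mequiv_group_comp _ _ _ _ _ _ 1) => x; rewrite conjg1.
      apply: (@mequiv_group_comp _ _ _ _ _ _ 1) => x /=.
      by rewrite gmulf1 conjg1.
    rewrite !arrow_compA s1B s1C !arrow_compE; split; apply/mclass_eq;
    by apply: (@mequiv_group_comp _ _ _ _ _ _ 1) => x; rewrite conjg1.
  exact: pV tt.
move: s1B s1C s2B s2C; rewrite !arrow_compE => /mclass_eq/mequiv_vertex[b1 B1].
move=> /mclass_eq/mequiv_vertex[c1 C1] /mclass_eq/mequiv_vertex[b2 B2].
move=> /mclass_eq/mequiv_vertex[c2 C2].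
move: (mV t1 tt) (mV t2 tt) B1 C1 B2 C2; rewrite -vertexE.
move=> m1 m2 B1 C1 B2 C2.
have {}B1 x : mV rB' _ (m1 x) ^ b1 = x := esym (B1 x).
have {}B2 x : mV rB' _ (m2 x) ^ b2 = x := esym (B2 x).
have {}C1 x : mV rC' _ (m1 x) ^ c1 = x := esym (C1 x).
(* Both rB' m1 and rB' m2 are inner, so m1 and m2 differ by an inner
   automorphism of G. *)
have m12 x : m2 x = m1 (x ^ (b2^-1 * b1)).
  apply: (@mono_inj _ _ (mV rB' _)); apply: (@conjg_inj _ b1).
  by rewrite B1 conjgM -[in RHS](B2 x) conjgK.
have [x] := outer (b2^-1 * b1 * (c1^-1 * c2)); apply.
by rewrite conjgM -[x ^ (b2^-1 * b1)]C1 -m12 conjgM conjgK C2.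
Qed.
End Outer.

(** The regular representation of an abelian group turns inversion, outer unless
    it is trivial, into conjugation by a permutation. *)
Section Cayley.
Variable G : finGroupType.
Hypothesis mulgC : commutative (@mul G).

Definition translation (k : G) : {perm G} := perm (@mulIg G k).

Lemma translation_morph : {morph translation : k l / k * l}.
Proof. by move=> k l; apply/permP => x; rewrite permM !permE mulgA. Qed.

Lemma translation_inj : injective translation.
Proof. by move=> k l /permP/(_ 1); rewrite !permE !mul1g. Qed.

Definition inversion : {perm G} := perm (@invg_inj G).

Lemma invg_morph : {morph (fun k : G => k^-1) : k l / k * l}.
Proof. by move=> k l; rewrite invgM mulgC. Qed.

Definition translation_mono : mono G {perm G} :=
  mono_of translation_morph translation_inj.

Definition invg_mono : mono G G := mono_of invg_morph (@invg_inj G).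

Lemma translation_conj k :
  translation_mono (invg_mono k) = translation_mono k ^ inversion.
Proof.
rewrite /= conjgE; apply: (@mulgI _ inversion); rewrite mulVKg.
by apply/permP => x; rewrite !permM !permE invgM mulgC.
Qed.

Lemma no_pullback_abelian : (exists k : G, k^-1 <> k) ->
  exists (A B C : graph_of_groups) (muB : morphism B A) (muC : morphism C A),
    ~ has_pullback GrGp (mclass muB) (mclass muC).
Proof.
move=> [k kV]; eexists _, _, _, _, _.
apply: no_pullback_outer translation_conj _ => c.
by exists k; rewrite conjgE (mulgC k) mulKg.
Qed.
End Cayley.

Theorem theoremB :
  (exists (A B C : graph_of_groups) (muB : morphism B A) (muC : morphism C A),
      ~ has_pullback GrGp (mclass muB) (mclass muC))
  /\
  (forall (A B C : graph_of_groups) (muB : morphism B A) (muC : morphism C A)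
      (P : graph_of_groups) (rhoB : arrow P B) (rhoC : arrow P C),
      is_pullback GrGp (mclass muB) (mclass muC) rhoB rhoC ->
      forall ch : product_choice muB muC,
      exists S : subgraph (product ch),
        isomorphic GrGp P (sub_graph_of_groups S)).
Proof.
split.
  apply: (@no_pullback_abelian 'I_3).
    by move=> x y; apply: val_inj; rewrite /= addnC.
  by exists (@Ordinal 3 1 isT) => /(congr1 val).
move=> A B C muB muC P rhoB rhoC [/= square univ] ch.
have [rB eB] := mclassP rhoB; have [rC eC] := mclassP rhoC; subst rhoB rhoC.
have {square} /mclass_eq square :
    mclass (mor_comp muB rB) = mclass (mor_comp muC rC).
  by rewrite -!arrow_compE.
have [s [sB sC]] := product_weak_pullback ch square.
have [|t [[tB tC] _]] :=
  univ (product ch) (mclass (projB ch)) (mclass (projC ch)).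
  by rewrite !arrow_compE; apply/mclass_eq/proj_square.
have [|u [_ uniq]] := univ P (mclass rB) (mclass rC).
  by rewrite !arrow_compE; apply/mclass_eq.
have [t' et] := mclassP t; subst t.
(* Both t' s and the identity factor the square (rB, rC) through P. *)
exists (image_subgraph s); apply: (@retract_isomorphic _ _ s t').
apply/mclass_eq; rewrite -arrow_compE.
rewrite -(uniq (mclass (mor_id P))); last by rewrite !arrow_comp1r.
apply/esym/uniq; rewrite !arrow_compA tB tC !arrow_compE.
by split; apply/mclass_eq.
Qed.
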